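(* Let $s>p\ge2$ with $s$ an integer, $q=s-1$, $\nu:=\frac1p-\frac1s$, let $f:\mathbb{R}^d\to\mathbb{R}$ be convex and $q^{th}$-order $L_q$ smooth with respect to $\|\cdot\|_p$, with minimizer $x^\star$, and let $x_0\in\mathbb{R}^d$ and $\epsilon>0$. The General Proximal Point Algorithm (described in the context), in which the $\sigma$-$\mathrm{GMS}_p$ oracle (with $\sigma=O(1)$, $\sigma\in[0,1)$) is implemented by a $(p,s)$-Taylor oracle, finds $\tilde x$ such that $f(\tilde x)-f(x^\star)\le\epsilon$ in $$O_{p,s}\left(\|x_0-x^\star\|_p^{\frac{1}{1+\nu}}\left(\frac{L_q}{\epsilon}\right)^{\frac{1}{s(1+\nu)}}\right)$$ iterations. The cost of each iteration is at most $O(d)$ plus the cost of the $(p,s)$-Taylor oracle.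
   Context: $\|\cdot\|_p$ is the standard $\ell_p$ norm and $p^*=\frac p{p-1}$. $O_{p,s}(\cdot)$ hides multiplicative factors depending only on $p$ and $s$. For $q\ge1$, $\mathcal{T}_f^q(y;x):=f(x)+\sum_{i=1}^q\frac1{i!}\nabla^if(x)[y-x]^i$ is the $q^{th}$-order Taylor expansion of $f$ at $x$. $f$ is $q^{th}$-order $L_q$ smooth with respect to $\|\cdot\|_p$ if $\|\nabla f(y)-\nabla_y\mathcal{T}_f^q(y;x)\|_{p^*}\le\frac{L_q}{q!}\|y-x\|_p^q$ for all $x,y\in\mathbb{R}^d$. A $(p,s)$-Taylor oracle returns, for a centering point $c$, the solution of $\min_{x\in\mathbb{R}^d}\mathcal{T}_f^{s-1}(x;c)+\frac{L_{s-1}}{(s-1)!}\|x-c\|_p^s$. A $\sigma$-$\mathrm{GMS}_p$ oracle for $f$ is a map $\mathcal{O}:\mathbb{R}^d\to\mathbb{R}^d\times\mathbb{R}_+$ such that for every $y$, $(x,\gamma)=\mathcal{O}(y)$ satisfies $\langle\nabla f(x),x-y\rangle\le-(1-\sigma)\gamma\|x-y\|_p^p$ and $\|\nabla f(x)\|_{p^*}\le(1+\sigma)\gamma\|x-y\|_p^{p-1}$. It satisfies an $(s,\mu)$ movement bound if moreover $\|x-y\|_p\ge(\gamma/\mu^s)^{1/(s-p)}$. That it is implemented by a $(p,s)$-Taylor oracle means that, for a suitable choice of $\gamma$ (depending on $y$ and $x$), the pair $(x,\gamma)$ with $x$ the output of the $(p,s)$-Taylor oracle at $y$ is used as its output; $\mu>0$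 is a suitable corresponding movement bound parameter. General Proximal Point Algorithm. Parameters: the constant $\sigma\in[0,1)$ of the $\sigma$-$\mathrm{GMS}_p$ oracle $\mathcal{O}$ implemented by the $(p,s)$-Taylor oracle, a number $\mu>0$ for which $\mathcal{O}$ satisfies an $(s,\mu)$ movement bound, and $R$ with $\|x_0-x^\star\|_p\le R=O(\|x_0-x^\star\|_p)$. Initialize $A_0=0$, $z_0=y_0=x_0$, $\bar\lambda_1=1$, $T_{\mathrm{ref}}=1$. For $t=0,\dots,T-1$: 1. If $t\ge1$: if $A_t\ge2A_{T_{\mathrm{ref}}}$, set $T_{\mathrm{ref}}=t$; then set $\bar\lambda_{t+1}=A_{T_{\mathrm{ref}}}^{-\frac{(s-p)(p+1)}{ps-p+s}}(R^p)^{\frac{p(s-p)}{ps-p+s}}\mu^{\frac{sp^2}{ps-p+s}}$. 2. Let $a_{t+1}>0$ be determined by $\bar\lambda_{t+1}\left(\frac{3+3\sigma}{1-\sigma}a_{t+1}\right)^p=(A'_{t+1})^{p-1}$, where $A'_{t+1}=A_t+a_{t+1}$. 3. $y_t=\frac{A_t}{A'_{t+1}}x_t+\frac{a_{t+1}}{A'_{t+1}}z_t$. 4. $(x'_{t+1},\lambda_{t+1})=\mathcal{O}(y_t)$. 5. $\beta_{t+1}=\min\{1,\bar\lambda_{t+1}/\lambda_{t+1}\}$ (equal to $1$ if $\lambda_{t+1}=0$). 6. $z_{t+1}=\arg\min_{z\in\mathbb{R}^d}\sum_{i=1}^{t+1}a_i\beta_i\langle\nabla f(x'_i),z\rangle+\|z-x_0\|_p^p$.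 7. $x_{t+1}=\frac{(1-\beta_{t+1})A_tx_t+\beta_{t+1}A'_{t+1}x'_{t+1}}{A_t+\beta_{t+1}a_{t+1}}$ and $A_{t+1}=A_t+\beta_{t+1}a_{t+1}$. Return $\tilde x=x_T$.
   Formalization: As λ̄_1=1 makes a uniform bound false for small L_q, it is claimed for all ε only if L_q‖x_0−x*‖_p^{s−p}≥1, else for ε below a threshold depending on p,s,L_q,‖x_0−x*‖_p and R's constant; L_q>0, T≥1; ∇f comes with the oracle call, the root a_{t+1} has unit cost. *)

(* Defs.v *)
From mathcomp Require Import all_boot all_order all_algebra.
From mathcomp Require Import all_classical all_reals all_analysis.
Import Order.TTheory GRing.Theory Num.Theory.
Import numFieldNormedType.Exports.

Set Implicit Arguments.
Unset Strict Implicit.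
Unset Printing Implicit Defensive.

Local Open Scope classical_set_scope.
Local Open Scope ring_scope.

Definition lpnorm (R : realType) (d : nat) (p : R) (x : 'rV[R]_d) : R :=
  (\sum_(i < d) `|x 0 i| `^ p) `^ p^-1.

Definition conj_exponent (R : realType) (p : R) : R := p / (p - 1).

Definition inner (R : realType) (d : nat) (u v : 'rV[R]_d) : R :=
  \sum_(i < d) u 0 i * v 0 i.

Definition grad (R : realType) (d : nat) (f : 'rV[R]_d -> R)
    (x : 'rV[R]_d) : 'rV[R]_d :=
  \row_i 'D_(delta_mx 0 i : 'rV[R]_d) f x.

(* [q] times Frechet differentiable on the whole space: in finite dimension,   *)
(* the differential is again differentiable iff all directional derivatives    *)
(* are.                                                                        *)
Fixpoint times_differentiable (R : realType) (d q : nat)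
    (f : 'rV[R]_d -> R) : Prop :=
  if q is q'.+1 then
    (forall x, differentiable f x) /\
    (forall v, times_differentiable q' ('D_v f))
  else True.

(* The diagonal value (nabla^i f)(x)[h]^i, as an iterated derivative of [f]    *)
(* in the fixed direction [h].                                                 *)
Definition nabla_diag (R : realType) (d i : nat) (f : 'rV[R]_d -> R)
    (x h : 'rV[R]_d) : R :=
  iter i (fun g : 'rV[R]_d -> R => 'D_h g) f x.

Definition taylor (R : realType) (d q : nat) (f : 'rV[R]_d -> R)
    (y x : 'rV[R]_d) : R :=
  f x + \sum_(1 <= i < q.+1) (i`!)%:R^-1 * nabla_diag i f x (y - x).

Definition smooth (R : realType) (d : nat) (p : R) (q : nat) (L : R)
    (f : 'rV[R]_d -> R) : Prop :=
  times_differentiable q f /\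
  forall x y : 'rV[R]_d,
    lpnorm (conj_exponent p) (grad f y - grad (fun y' => taylor q f y' x) y)
      <= L / (q`!)%:R * lpnorm p (y - x) ^+ q.

Definition taylor_oracle (R : realType) (d : nat) (p : R) (s : nat) (L : R)
    (f : 'rV[R]_d -> R) (O : 'rV[R]_d -> 'rV[R]_d) : Prop :=
  let model c x :=
    taylor s.-1 f x c + L / (s.-1`!)%:R * lpnorm p (x - c) ^+ s in
  forall c x : 'rV[R]_d, model c (O c) <= model c x.

Definition gms_oracle (R : realType) (d : nat) (p sigma : R)
    (f : 'rV[R]_d -> R) (O : 'rV[R]_d -> 'rV[R]_d * R) : Prop :=
  forall y : 'rV[R]_d, let: (x, gamma) := O y in
  [/\ 0 <= gamma,
      inner (grad f x) (x - y)
        <= - ((1 - sigma) * gamma * lpnorm p (x - y) `^ p)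
    & lpnorm (conj_exponent p) (grad f x)
        <= (1 + sigma) * gamma * lpnorm p (x - y) `^ (p - 1)].

Definition movement_bound (R : realType) (d : nat) (p : R) (s : nat) (mu : R)
    (O : 'rV[R]_d -> 'rV[R]_d * R) : Prop :=
  forall y : 'rV[R]_d, let: (x, gamma) := O y in
  (gamma / mu ^+ s) `^ (s%:R - p)^-1 <= lpnorm p (x - y).

(* All quantities produced by the algorithm, indexed as in its description.    *)
(* [tref t] is the value of T_ref when iteration [t] starts; iteration [t]     *)
(* therefore uses the updated value [tref t.+1].                               *)
Record trace (R : realType) (d : nat) := Trace {
  iterx : nat -> 'rV[R]_d;
  iterx' : nat -> 'rV[R]_d;
  itery : nat -> 'rV[R]_d;
  iterz : nat -> 'rV[R]_d;
  stepa : nat -> R;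
  sumA : nat -> R;
  lam : nat -> R;
  lambar : nat -> R;
  beta : nat -> R;
  tref : nat -> nat
}.

Definition grad_sum (R : realType) (d : nat) (f : 'rV[R]_d -> R)
    (tr : trace R d) (t : nat) : 'rV[R]_d :=
  \sum_(1 <= i < t.+1) (stepa tr i * beta tr i) *: grad f (iterx' tr i).

Definition lambar_rule (R : realType) (p : R) (s : nat) (mu Rad Aref : R) : R :=
  let N := p * s%:R - p + s%:R in
  Aref `^ (- ((s%:R - p) * (p + 1) / N))
  * (Rad `^ p) `^ (p * (s%:R - p) / N)
  * mu `^ (s%:R * p ^+ 2 / N).

Definition step_coef (R : realType) (sigma : R) : R :=
  (3 + 3 * sigma) / (1 - sigma).

Record gppa_iteration (R : realType) (d : nat) (p : R) (s : nat)
    (sigma mu Rad : R) (f : 'rV[R]_d -> R) (O : 'rV[R]_d -> 'rV[R]_d * R)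
    (x0 : 'rV[R]_d) (tr : trace R d) (t : nat) : Prop := GppaIteration {
  gppa_tref : tref tr t.+1 =
    if (0 < t)%N && (2 * sumA tr (tref tr t) <= sumA tr t)
    then t else tref tr t;
  gppa_lambar : lambar tr t.+1 =
    if t == 0%N then 1 else lambar_rule p s mu Rad (sumA tr (tref tr t.+1));
  gppa_stepa_gt0 : 0 < stepa tr t.+1;
  gppa_stepa :
    lambar tr t.+1 * (step_coef sigma * stepa tr t.+1) `^ p
    = (sumA tr t + stepa tr t.+1) `^ (p - 1);
  gppa_y : let A' := sumA tr t + stepa tr t.+1 in
    itery tr t =
      (sumA tr t / A') *: iterx tr t + (stepa tr t.+1 / A') *: iterz tr t;
  gppa_oracle : (iterx' tr t.+1, lam tr t.+1) = O (itery tr t);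
  gppa_beta : beta tr t.+1 =
    if lam tr t.+1 == 0 then 1 else Num.min 1 (lambar tr t.+1 / lam tr t.+1);
  gppa_z :
    let phi z :=
      \sum_(1 <= i < t.+2)
        stepa tr i * beta tr i * inner (grad f (iterx' tr i)) z
      + lpnorm p (z - x0) `^ p in
    forall z : 'rV[R]_d, phi (iterz tr t.+1) <= phi z;
  gppa_x : let A' := sumA tr t + stepa tr t.+1 in
    iterx tr t.+1 =
      (sumA tr t + beta tr t.+1 * stepa tr t.+1)^-1 *:
        (((1 - beta tr t.+1) * sumA tr t) *: iterx tr t
         + (beta tr t.+1 * A') *: iterx' tr t.+1);
  gppa_A : sumA tr t.+1 = sumA tr t + beta tr t.+1 * stepa tr t.+1
}.

Definition gppa_run (R : realType) (d : nat) (p : R) (s : nat)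
    (sigma mu Rad : R) (f : 'rV[R]_d -> R) (O : 'rV[R]_d -> 'rV[R]_d * R)
    (x0 : 'rV[R]_d) (T : nat) (tr : trace R d) : Prop :=
  [/\ sumA tr 0 = 0, iterx tr 0 = x0, iterz tr 0 = x0, tref tr 0 = 1%N
    & forall t, (t < T)%N ->
        gppa_iteration p s sigma mu Rad f O x0 tr t].

(* Cost model: straight-line programs over scalar registers and registers      *)
(* holding vectors of R^d. A program does not mention d, nor any real constant *)
(* other than natural numbers. A scalar operation costs 1 and a coordinatewise *)
(* operation or a sum over coordinates costs d.                                *)
Inductive binop := OpAdd | OpSub | OpMul | OpDiv | OpPow.

Definition binop_eval (R : realType) (o : binop) (u v : R) : R :=
  match o with
  | OpAdd => u + v
  | OpSub => u - v
  | OpMul => u * v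
  | OpDiv => u / v
  | OpPow => u `^ v
  end.

(* The first argument of each instruction is the target register.              *)
Inductive instr :=
| SConst of nat & nat
| SOp of binop & nat & nat & nat
| SSel of nat & nat & nat & nat & nat
| SRoot of nat & nat & nat & nat & nat
| VFill of nat & nat
| VOp of binop & nat & nat & nat
| VSel of nat & nat & nat & nat & nat
| VSum of nat & nat
| Oracle of nat & nat & nat.

Definition program := seq instr.

Record memory (R : realType) (d : nat) := Memory {
  sreg : nat -> R;
  vreg : nat -> 'rV[R]_d
}.

Definition update (X : Type) (r : nat -> X) (k : nat) (v : X) : nat -> X :=
  fun j => if j == k then v else r j.

(* The positive root [a] of the scalar equation that defines the step size.    *)
Definition step_root (R : realType) (p c l A : R) : R :=
  xget 0 [set a : R | 0 < a /\ l * (c * a) `^ p = (A + a) `^ (p - 1)].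

(* A call of the Taylor oracle at a center delivers the solution [x] of the    *)
(* model problem together with the first-order information [grad f x].         *)
Definition exec_instr (R : realType) (d : nat) (f : 'rV[R]_d -> R)
    (O : 'rV[R]_d -> 'rV[R]_d) (m : memory R d) (c : instr) : memory R d :=
  let: Memory sr vr := m in
  match c with
  | SConst k n => Memory (update sr k n%:R) vr
  | SOp o k i j => Memory (update sr k (binop_eval o (sr i) (sr j))) vr
  | SSel k i j u v =>
      Memory (update sr k (if sr i <= sr j then sr u else sr v)) vr
  | SRoot k ip ic il iA =>
      Memory (update sr k (step_root (sr ip) (sr ic) (sr il) (sr iA))) vr
  | VFill k i => Memory sr (update vr k (\row_j sr i))
  | VOp o k i j =>
      Memory sr (update vr k (\row_l binop_eval o (vr i 0 l) (vr j 0 l)))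
  | VSel k i j u v =>
      Memory sr (update vr k
        (\row_l if vr i 0 l <= vr j 0 l then vr u 0 l else vr v 0 l))
  | VSum k i => Memory (update sr k (\sum_l vr i 0 l)) vr
  | Oracle kx kg i =>
      Memory sr (update (update vr kx (O (vr i))) kg (grad f (O (vr i))))
  end.

Definition exec (R : realType) (d : nat) (f : 'rV[R]_d -> R)
    (O : 'rV[R]_d -> 'rV[R]_d) (P : program) (m : memory R d) : memory R d :=
  foldl (exec_instr f O) m P.

(* [tau] is the cost of one call of the Taylor oracle.                         *)
Definition instr_cost (d tau : nat) (c : instr) : nat :=
  match c with
  | SConst _ _ | SOp _ _ _ _ | SSel _ _ _ _ _ | SRoot _ _ _ _ _ => 1
  | VFill _ _ | VOp _ _ _ _ | VSel _ _ _ _ _ | VSum _ _ => d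
  | Oracle _ _ _ => tau
  end.

Definition program_cost (d tau : nat) (P : program) : nat :=
  \sum_(c <- P) instr_cost d tau c.

(* What is kept in memory between iterations. Before iteration 0 the value     *)
(* A_(T_ref) = A_1 does not exist yet.                                         *)
Definition holds_state (R : realType) (d : nat) (p : R) (s : nat)
    (sigma mu Rad : R) (f : 'rV[R]_d -> R) (x0 : 'rV[R]_d)
    (tr : trace R d) (t : nat) (m : memory R d) : Prop :=
  [/\ [/\ sreg m 0 = p, sreg m 1 = s%:R, sreg m 2 = sigma, sreg m 3 = mu
        & sreg m 4 = Rad],
      [/\ sreg m 5 = t%:R, sreg m 6 = sumA tr t
        & (0 < t)%N -> sreg m 7 = sumA tr (tref tr t)]
    & [/\ vreg m 0 = x0, vreg m 1 = iterx tr t, vreg m 2 = iterz tr t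
        & vreg m 3 = grad_sum f tr t]].

Definition iteration_bound (R : realType) (p : R) (s : nat) (D L eps : R) : R :=
  let nu := p^-1 - s%:R^-1 in
  D `^ (1 + nu)^-1 * (L / eps) `^ (s%:R * (1 + nu))^-1.

(* Main.v *)
Require Import Defs.
From HB Require Import structures.
From mathcomp Require Import all_boot all_order all_algebra.
From mathcomp Require Import all_classical all_reals all_analysis.
From mathcomp Require Import ring lra zify.
Import Order.TTheory GRing.Theory Num.Theory.
Import numFieldNormedType.Exports.

Local Open Scope classical_set_scope.
Local Open Scope ring_scope.

Set Implicit Arguments.
Unset Strict Implicit.
Unset Printing Implicit Defensive.

(** The method is an accelerated proximal point scheme; the theorem rests on the
following facts.

A Taylor step is a proximal step.  At the minimizer [x] of the regularized
Taylor model at [y], the gradient of the Taylor polynomial cancels that of the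
regularizer, which is [gamma] times the duality map of [x - y], where
[gamma = (s L / (s-1)!) r^(s-p)] and [r] is the p-norm of [x - y].  By
smoothness the gradient of [f] differs from the gradient of the polynomial by at
most a fraction [1/s] of the norm [gamma r^(p-1)] of this vector.  Hence the
oracle inequalities hold as soon as [sigma >= 1/s], for instance with
[sigma = 1/2], and the movement bound holds with equality for
[mu^s = s L / (s-1)!] ([taylor_step_gms]).

A potential decreases.  The sums of the linear lower bounds of [f] collected so
far, plus the p-th power of the distance to [x0], dominate the value
[A_t f(x_t)] plus a fixed fraction of the accumulated movement [E_t], the sum of
the terms [A'_i beta_i lambda_i r_i^p].  One iteration preserves this because
the p-th power of the p-norm is uniformly convex for [p >= 2] (Clarkson), and
because the equation for the step size makes the linear error term absorbable
by the movement and by the uniform convexity ([accelerated_step]).  Therefore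
[A_t (f(x_t) - f(xstar)) + c E_t <= D^p] ([run_value_bound]).

The weights grow.  Put [u_t = (mu^s Rad^(s-p) A_t)^rho] with
[rho = p / (ps - p + s)], which is [1 / (s (1 + nu))].  The rule for [lambar]
equalizes two effects.  An iteration with [beta = 1] increases [u] by a constant,
since the rule says that [A lambar = u^p] at the reference weight.  An iteration
with [beta < 1] has moved far, so far that [E] increases by at least [Rad^p / u].
As [E] is at most a multiple of [Rad^p], and as [u] is monotone, the number of
iterations of either kind is at most a multiple of the last [u]
([run_counting_step], [run_length]).  Hence [A_T] is at least of the order
[T^(1/rho) / (mu^s Rad^(s-p))], and the potential gives the rate.

The constant increase of [u] requires [u] to be bounded below, that is, a
first weight that is not too small.  This follows from the potential at the
first iteration when [L D^(s-p) >= 1] ([first_weight]).  Otherwise the lower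
bound depends on [L] and [D], the first iterations until [u >= 1] form a burn-in
whose length depends on the same data, and for a small enough accuracy this
burn-in takes at most half of the iterations ([run_length_after_burn_in],
[gppa_rate]).

Finally, the step size is the unique root of its equation ([step_root_spec],
[step_size_unique]) and the prox center has a closed form ([prox_center]), so
that the method never gets stuck ([gppa_trace_run]) and one iteration is a fixed
straight-line program ([gppa_program_correct]). *)

(** * Real powers and p-norms *)

(** The signed power, which is the derivative
of [|x|^(a + 1) / (a + 1)] for [a > 0]. *)
Definition spow (R : realType) (a x : R) : R := Num.sg x * `|x| `^ a.

Lemma powR_superadditive (R : realType) (a x y : R) :
  1 <= a -> 0 <= x -> 0 <= y -> x `^ a + y `^ a <= (x + y) `^ a.
Proof.
move=> a1 x0 y0.
have a0 : 0 < a by apply: lt_le_trans a1.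
have a10 : 0 <= a - 1 by rewrite subr_ge0.
rewrite -(mulr_powRB1 x0 a0) -(mulr_powRB1 y0 a0).
rewrite -(mulr_powRB1 (addr_ge0 x0 y0) a0) mulrDl.
by apply: lerD; apply: ler_wpM2l => //; apply: ge0_ler_powR => //;
  rewrite ?nnegrE ?addr_ge0 // ?lerDl ?lerDr.
Qed.

Lemma powR_midpoint (R : realType) (a x y : R) :
  1 <= a -> 0 <= x -> 0 <= y ->
  ((x + y) / 2) `^ a <= (x `^ a + y `^ a) / 2.
Proof.
move=> a1 x0 y0.
have h0 : 0 <= 2^-1 :> R by lra.
have h1 : 2^-1 <= 1 :> R by lra.
have := @convex_powR R a a1 (Itv01 h0 h1) x y.
rewrite !inE /= !in_itv /= !andbT => /(_ x0 y0).
rewrite convRE [X in X `^ _ <= _ -> _]convRE /= /unstable.onem.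
have -> : 1 - 2^-1 = 2^-1 :> R by lra.
have e (u v : R) : 2^-1 * u + 2^-1 * v = (u + v) / 2 by field.
by rewrite !e.
Qed.

Lemma sqr_powR_half (R : realType) (p x : R) :
  (x ^+ 2) `^ (p / 2) = `|x| `^ p.
Proof.
rewrite -real_normK ?num_real // -(powR_mulrn 2) // -powRrM.
by congr (_ `^ _); field.
Qed.

(** By convexity of [t^(p/2)], the mean of the two powers on the right is at
least [(m^2 + h^2)^(p/2)], and [t^(p/2)] is superadditive. *)
Lemma scalar_clarkson (R : realType) (p m h : R) : 2 <= p ->
  2 * `|m| `^ p + 2 * `|h| `^ p <= `|m + h| `^ p + `|m - h| `^ p.
Proof.
move=> p2; rewrite -!(sqr_powR_half p).
have q1 : 1 <= p / 2 by lra.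
have h1 := powR_midpoint q1 (sqr_ge0 (m + h)) (sqr_ge0 (m - h)).
have h2 := powR_superadditive q1 (sqr_ge0 m) (sqr_ge0 h).
have e : ((m + h) ^+ 2 + (m - h) ^+ 2) / 2 = m ^+ 2 + h ^+ 2 by field.
rewrite e in h1; lra.
Qed.

Lemma mul_spow (R : realType) (p x : R) : 0 < p ->
  spow (p - 1) x * x = `|x| `^ p.
Proof.
move=> p0; rewrite /spow mulrAC -normrEsg mulr_powRB1 //.
Qed.

Lemma norm_spow (R : realType) (a x : R) : a != 0 ->
  `|spow a x| = `|x| `^ a.
Proof.
move=> a0; rewrite /spow normrM (ger0_norm (powR_ge0 _ _)) normr_sg.
by case: eqVneq => [->|_]; rewrite ?normr0 ?powR0 ?mulr0 ?mul1r.
Qed.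

Lemma conj_exponent_spec (R : realType) (p : R) : 1 < p ->
  [/\ 0 < conj_exponent p, p^-1 + (conj_exponent p)^-1 = 1,
      conj_exponent p - 1 = (p - 1)^-1 & (p - 1) * conj_exponent p = p].
Proof.
move=> p1; rewrite /conj_exponent; have pm : 0 < p - 1 by lra.
have pn : p - 1 != 0 by rewrite gt_eqF.
have pz : p != 0 by rewrite gt_eqF //; lra.
split; first by rewrite divr_gt0 //; lra.
- by field; rewrite pn pz.
- by field.
- by field.
Qed.

Lemma powR_young (R : realType) (p a b : R) : 1 < p -> 0 <= a -> 0 <= b ->
  p * (a `^ (p - 1) * b) <= (p - 1) * a `^ p + b `^ p.
Proof.
move=> p1 a0 b0; have p0 : 0 < p by lra.
have [q0 pq q1 pmq] := conj_exponent_spec p1.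
have := conjugate_powR b0 (powR_ge0 a (p - 1)) p0 q0 pq.
rewrite -powRrM pmq -(ler_pM2l p0) mulrC [b * _]mulrC => h.
rewrite mulrC; apply: le_trans h _.
have pm : p - 1 != 0 by rewrite gt_eqF // subr_gt0.
rewrite le_eqVlt; apply/orP; left; apply/eqP.
by rewrite /conj_exponent; field; rewrite pm gt_eqF.
Qed.

(** Convexity of [|.|^p] without differentiation: multiplied out, this is
Young's inequality between [|u|^(p-1)] and [|v|]. *)
Lemma powR_tangent (R : realType) (p u v : R) : 1 < p ->
  `|u| `^ p + p * spow (p - 1) u * (v - u) <= `|v| `^ p.
Proof.
move=> p1; have p0 : 0 < p by lra.
have := powR_young p1 (normr_ge0 u) (normr_ge0 v).
have h : spow (p - 1) u * v <= `|u| `^ (p - 1) * `|v|.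
  rewrite -(@norm_spow _ (p - 1) u) ?gt_eqF //; last lra.
  by rewrite -normrM ler_norm.
rewrite -(ler_pM2l p0) in h.
have e := mul_spow u p0.
have -> : p * spow (p - 1) u * (v - u)
  = p * (spow (p - 1) u * v) - p * (spow (p - 1) u * u) by ring.
rewrite e; lra.
Qed.

(** Clarkson's inequality bounds the value at [v] from below by the value at
the midpoint of [u] and [v], where the tangent at [u] applies. *)
Lemma powR_uniformly_convex (R : realType) (p u v : R) : 2 <= p ->
  `|u| `^ p + p * spow (p - 1) u * (v - u) + 2 * `|(v - u) / 2| `^ p
    <= `|v| `^ p.
Proof.
move=> p2.
have := scalar_clarkson ((u + v) / 2) ((v - u) / 2) p2.
have -> : (u + v) / 2 + (v - u) / 2 = v by field.
have -> : (u + v) / 2 - (v - u) / 2 = u by field.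
have := @powR_tangent _ p u ((u + v) / 2) ltac:(lra).
have -> : (u + v) / 2 - u = (v - u) / 2 by field.
lra.
Qed.

(** Sealed, so that two different norms are never compared by unfolding the
real powers in them. *)
HB.lock Definition pnorm (R : realType) (d : nat) (p : R) (x : 'rV[R]_d) : R :=
  lpnorm p x.

Lemma pnormE (R : realType) (d : nat) (p : R) (x : 'rV[R]_d) :
  lpnorm p x = pnorm p x.
Proof. by rewrite pnorm.unlock. Qed.

Section LpNorm.
Variables (R : realType) (d : nat).
Implicit Types (p : R) (x u v w : 'rV[R]_d).

Lemma pnorm_ge0 p x : 0 <= pnorm p x.
Proof. by rewrite -pnormE powR_ge0. Qed.

Lemma sum_powR_ge0 p x : 0 <= \sum_(i < d) `|x 0 i| `^ p.
Proof. by apply: sumr_ge0 => i _; apply: powR_ge0. Qed.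

Lemma pnorm_powR p x : p != 0 ->
  pnorm p x `^ p = \sum_(i < d) `|x 0 i| `^ p.
Proof. by move=> p0; rewrite -!pnormE /lpnorm -powRrM mulVf // powRr1 ?sum_powR_ge0. Qed.

Lemma pnorm_eq0 p x : 0 < p -> pnorm p x = 0 -> x = 0.
Proof.
move=> p0; rewrite -pnormE => /powR_eq0_eq0 /eqP; rewrite psumr_eq0; last by move=> i _; apply: powR_ge0.
move=> /allP h; apply/rowP => i; rewrite mxE; apply/eqP.
have := h i; rewrite mem_index_enum => /(_ isT) /=.
by move=> /eqP /powR_eq0_eq0 /normr0_eq0 ->.
Qed.

Lemma pnormZ p (c : R) x : 0 < p -> pnorm p (c *: x) = `|c| * pnorm p x.
Proof.
move=> p0; rewrite -!pnormE /lpnorm.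
under eq_bigr do rewrite mxE normrM powRM ?normr_ge0 //.
rewrite -mulr_sumr powRM ?powR_ge0 ?sum_powR_ge0 //.
by rewrite -powRrM mulfV ?gt_eqF // powRr1.
Qed.

Lemma pnormN p x : 0 < p -> pnorm p (- x) = pnorm p x.
Proof. by move=> p0; rewrite -scaleN1r pnormZ // normrN1 mul1r. Qed.

Lemma innerDl u v w : inner (u + v) w = inner u w + inner v w.
Proof. by rewrite /inner -big_split; apply: eq_bigr => i _; rewrite mxE mulrDl. Qed.

Lemma innerDr u v w : inner w (u + v) = inner w u + inner w v.
Proof. by rewrite /inner -big_split; apply: eq_bigr => i _; rewrite mxE mulrDr. Qed.

Lemma innerZl (c : R) u w : inner (c *: u) w = c * inner u w.
Proof. by rewrite /inner mulr_sumr; apply: eq_bigr => i _; rewrite mxE mulrA. Qed.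

Lemma innerZr (c : R) u w : inner w (c *: u) = c * inner w u.
Proof. by rewrite /inner mulr_sumr; apply: eq_bigr => i _; rewrite mxE mulrCA. Qed.

Lemma innerNr u w : inner w (- u) = - inner w u.
Proof. by rewrite -scaleN1r innerZr mulN1r. Qed.

Lemma innerBr u v w : inner w (u - v) = inner w u - inner w v.
Proof. by rewrite innerDr innerNr. Qed.

Lemma inner0l w : inner 0 w = 0.
Proof. by rewrite /inner big1 // => i _; rewrite mxE mul0r. Qed.

Lemma inner0r w : inner w 0 = 0.
Proof. by rewrite /inner big1 // => i _; rewrite mxE mulr0. Qed.

Lemma inner_suml (I : Type) (r : seq I) (P : pred I) (F : I -> 'rV[R]_d) w :
  inner (\sum_(i <- r | P i) F i) w = \sum_(i <- r | P i) inner (F i) w.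
Proof.
elim/big_rec2: _ => [|i y z _ <-]; first exact: inner0l.
by rewrite innerDl.
Qed.

(** Normalize both vectors and sum Young's inequality over the coordinates. *)
Lemma lp_holder p u v : 1 < p ->
  inner u v <= pnorm (conj_exponent p) u * pnorm p v.
Proof.
move=> p1; have p0 : 0 < p by lra.
have [q0 pq _ _] := conj_exponent_spec p1.
move: (conj_exponent p) q0 pq => q q0 pq.
have [u0|un] := eqVneq (pnorm q u) 0.
  by rewrite u0 (pnorm_eq0 q0 u0) inner0l mul0r.
have [v0|vn] := eqVneq (pnorm p v) 0.
  by rewrite v0 (pnorm_eq0 p0 v0) inner0r mulr0.
have U0 : 0 < pnorm q u by rewrite lt_neqAle eq_sym un pnorm_ge0.
have V0 : 0 < pnorm p v by rewrite lt_neqAle eq_sym vn pnorm_ge0.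
have UV0 : 0 < pnorm q u * pnorm p v := mulr_gt0 U0 V0.
suff h : (pnorm q u * pnorm p v)^-1 * inner u v <= 1.
  by rewrite (ler_pdivrMl _ _ UV0) mulr1 in h.
have unit (r : R) (x : 'rV[R]_d) : 0 < r -> pnorm r x != 0 ->
    \sum_(i < d) (`|x 0 i| / pnorm r x) `^ r = 1.
  move=> r0 xn; under eq_bigr => i _.
    rewrite powRM ?normr_ge0 ?invr_ge0 ?pnorm_ge0 //; over.
  rewrite -mulr_suml -pnorm_powR ?gt_eqF // -powRM ?invr_ge0 ?pnorm_ge0 //.
  by rewrite divff // powR1.
have <- : (\sum_(i < d) (`|v 0 i| / pnorm p v) `^ p) / p
        + (\sum_(i < d) (`|u 0 i| / pnorm q u) `^ q) / q = 1.
  by rewrite (unit p v p0 vn) (unit q u q0 un) !mul1r pq.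
rewrite !mulr_suml -big_split /= /inner mulr_sumr; apply: ler_sum => i _.
apply: le_trans (conjugate_powR _ _ p0 q0 pq); last first.
- by rewrite divr_ge0 // pnorm_ge0.
- by rewrite divr_ge0 // pnorm_ge0.
have -> : `|v 0 i| / pnorm p v * (`|u 0 i| / pnorm q u) =
   (pnorm q u * pnorm p v)^-1 * (`|u 0 i| * `|v 0 i|).
  by rewrite invfM; ring.
rewrite ler_wpM2l ?invr_ge0 ?mulr_ge0 ?pnorm_ge0 //.
by rewrite -normrM ler_norm.
Qed.

(** The duality map of the p-norm, that is, the gradient of its p-th power
divided by [p]. *)
Definition dual_map p (w : 'rV[R]_d) : 'rV[R]_d := \row_i spow (p - 1) (w 0 i).

Lemma inner_dual_map p w : 0 < p -> inner (dual_map p w) w = pnorm p w `^ p.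
Proof.
move=> p0; rewrite pnorm_powR ?gt_eqF // /inner.
by apply: eq_bigr => i _; rewrite mxE mul_spow.
Qed.

Lemma pnorm_dual_map p w : 1 < p ->
  pnorm (conj_exponent p) (dual_map p w) = pnorm p w `^ (p - 1).
Proof.
move=> p1; have [q0 pq q1 pmq] := conj_exponent_spec p1.
rewrite -!pnormE /lpnorm -powRrM.
have -> : p^-1 * (p - 1) = (conj_exponent p)^-1.
  by rewrite /conj_exponent invf_div mulrC.
congr (_ `^ _); apply: eq_bigr => i _.
by rewrite mxE norm_spow ?gt_eqF ?subr_gt0 // -powRrM pmq.
Qed.

(** The conjugate norm is the dual norm: the inner product is tested at the
dual vector of [u], where Hoelder's inequality is an equality. *)
Lemma pnorm_conj_le p (B : R) u : 1 < p -> 0 <= B ->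
  (forall v, inner u v <= B * pnorm p v) -> pnorm (conj_exponent p) u <= B.
Proof.
move=> p1 B0 h; have [q0 pq q1 pmq] := conj_exponent_spec p1.
have p0 : 0 < p by lra.
set q := conj_exponent p in q0 pq q1 pmq *.
have qq1 : 1 < q by rewrite -subr_gt0 q1 invr_gt0 subr_gt0.
have pe : conj_exponent q = p.
  by rewrite {1}/conj_exponent q1 invrK mulrC.
have := h (dual_map q u).
have -> : inner u (dual_map q u) = pnorm q u `^ q.
  rewrite -inner_dual_map // /inner; apply: eq_bigr => i _; exact: mulrC.
have := pnorm_dual_map u qq1; rewrite pe => ->.
have [->|un] := eqVneq (pnorm q u) 0; first by [].
have U0 : 0 < pnorm q u by rewrite lt_neqAle eq_sym un pnorm_ge0.
by rewrite -(mulr_powRB1 (ltW U0) q0) ler_pM2r // powR_gt0.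
Qed.

Lemma pnorm_conjD p u v : 1 < p ->
  pnorm (conj_exponent p) (u + v)
    <= pnorm (conj_exponent p) u + pnorm (conj_exponent p) v.
Proof.
move=> p1; apply: pnorm_conj_le => //; first by rewrite addr_ge0 ?pnorm_ge0.
by move=> w; rewrite innerDl mulrDl lerD ?lp_holder.
Qed.

End LpNorm.

(** * Derivatives along a line *)

(** Away from [0] this is the derivative of the real power on a half line; at
[0] the difference quotient has absolute value [|h|^(a - 1)]. *)
Lemma is_derive_abs_powR (R : realType) (a x : R) : 1 < a ->
  is_derive x 1 (fun t : R => `|t| `^ a) (a * spow (a - 1) x).
Proof.
move=> a1; have a0 : 0 < a by lra.
have [x0|x0|->] := ltgtP x 0.
- apply: (@near_eq_is_derive _ _ _ ((fun t => t `^ a) \o -%R)).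
    near=> t; rewrite /= ltr0_norm //; near: t; exact: lt_nbhsl.
  have dp : is_derive (- x) 1 (@powR R ^~ a) (a * (- x) `^ (a - 1)).
    by apply: is_derive1_powR; lra.
  have dn : is_derive x 1 (-%R : R -> R) (-1) by exact: is_deriveNid.
  apply: is_derive_eq (is_derive1_comp dp dn) _.
  by rewrite /spow ltr0_sg // ltr0_norm // mulN1r mulrN1 mulrN.
- apply: (@near_eq_is_derive _ _ _ (@powR R ^~ a)).
    near=> t; rewrite /= gtr0_norm //; near: t; exact: lt_nbhsr.
  rewrite /spow gtr0_sg // gtr0_norm // mul1r.
  exact: is_derive1_powR.
- rewrite /spow sgr0 mul0r mulr0.
  have h0 : (fun h : R => h^-1 *: (((fun t : R => `|t| `^ a) \o shift 0) (h *: 1)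
     - `|0 : R| `^ a)) @ 0^' --> (0 : R).
    apply/cvgrPdist_le => e e0.
    near=> h.
    have hn : h != 0 by near: h; exact: nbhs_dnbhs_neq.
    have hp : 0 < `|h| by rewrite normr_gt0.
    rewrite /= normr0 powR0 ?gt_eqF // subr0 addr0 sub0r normrN.
    rewrite [h *: 1]mulr1 normrM normfV (ger0_norm (powR_ge0 _ _)).
    rewrite -(mulr_powRB1 (normr_ge0 _) a0) mulKf ?gt_eqF //.
    have -> : e = (e `^ (a - 1)^-1) `^ (a - 1).
      by rewrite -powRrM mulVf ?gt_eqF ?subr_gt0 // powRr1 // ltW.
    apply: ge0_ler_powR; rewrite ?nnegrE ?powR_ge0 ?normr_ge0 ?subr_ge0 //.
      by lra.
    near: h; apply: dnbhs0_le; exact: powR_gt0.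
  split; first by apply/cvg_ex; exists 0.
  exact: cvg_lim h0.
Unshelve. all: by end_near. Qed.

Section Differential.
Variables (R : realType) (d : nat).
Implicit Types (f g : 'rV[R]_d -> R) (x h v : 'rV[R]_d).

Lemma derive_inner f x v : differentiable f x -> 'D_v f x = inner (grad f x) v.
Proof.
move=> df; rewrite deriveE // {1}[v]row_sum_delta linear_sum /inner.
by apply: eq_bigr => i _; rewrite linearZ mxE deriveE // mulrC.
Qed.

(** The difference quotients in the direction [y - x] are at most
[f y - f x] by convexity, hence so is their limit. *)
Lemma convex_gradient f x y :
  convex_function [set: 'rV[R]_d] f -> differentiable f x ->
  f x + inner (grad f x) (y - x) <= f y.
Proof.
move=> cf df; rewrite -lerBrDl -derive_inner //.
have dv : derivable f x (y - x) by exact: diff_derivable.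
rewrite /derive cvg_at_rightE //; apply: limr_le.
  have := dv; rewrite /derivable => h; apply/cvg_ex; eexists.
  apply: cvg_trans h; apply: cvg_app.
  by move=> A [e egt0 Ae]; exists e => // z xe xgt0; apply: Ae => //; exact/lt0r_neq0.
near=> t.
have t0 : 0 < t by near: t; exact: nbhs_right_gt.
have t1 : t <= 1 by near: t; exact: nbhs_right_le.
rewrite /=.
have := cf (Itv01 (ltW t0) t1) y x; rewrite !inE => /(_ I I).
rewrite convRE /= /conv /= /unstable.onem.
rewrite [_ *: _ + x](_ : _ = t *: y + (1 - t) *: x); last first.
  by rewrite scalerBr scalerBl scale1r -addrA; congr (_ + _); rewrite addrC.
move=> h; rewrite -[X in X <= _]/(_ * _) ler_pdivrMl //.
lra.
Unshelve. all: by end_near. Qed.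

End Differential.

(** * The Taylor step is a proximal step *)

Section Taylor.
Variables (R : realType) (d : nat).
Implicit Types (f g : 'rV[R]_d -> R) (x h v w c : 'rV[R]_d).

Lemma times_differentiable_le (i q : nat) f :
  (i <= q)%N -> times_differentiable q f -> times_differentiable i f.
Proof.
elim: q i f => [|q IH] [|i] f //= iq [df dvf].
by split=> // v; apply: IH (dvf v).
Qed.

Lemma iter_derive_sum (i n : nat) (c : 'I_n -> R) (g : 'I_n -> 'rV[R]_d -> R) h :
  (forall j, times_differentiable i (g j)) ->
  iter i (fun g : 'rV[R]_d -> R => 'D_h g) (fun x => \sum_j c j * g j x) =
  (fun x => \sum_j c j * iter i (fun g : 'rV[R]_d -> R => 'D_h g) (g j) x).
Proof.
elim: i g => [|i IH] g dg //.
rewrite iterSr.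
have -> : 'D_h (fun x => \sum_j c j * g j x)
    = (fun x => \sum_j c j * 'D_h (g j) x).
  apply/funext => x.
  have -> : (fun x => \sum_j c j * g j x) = \sum_j (c j *: g j).
    by apply/funext => y; rewrite fct_sumE.
  rewrite derive_sum => [|j]; last first.
    by apply: derivableZ; apply: diff_derivable; case: (dg j).
  apply: eq_bigr => j _; rewrite deriveZ //.
  by apply: diff_derivable; case: (dg j).
rewrite IH => [|j]; last by case: (dg j) => _; apply.
by apply/funext => x; apply: eq_bigr => j _; rewrite iterSr.
Qed.

(** The innermost derivative is expanded over the coordinates of the direction,
and the remaining ones are linear in the function. *)
Lemma nabla_diagS (i : nat) f x h : times_differentiable i.+1 f ->
  nabla_diag i.+1 f x h
  = \sum_(j < d) h 0 j * nabla_diag i ('D_(delta_mx 0 j) f) x h.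
Proof.
move=> [df dvf]; rewrite /nabla_diag iterSr.
have -> : 'D_h f = (fun y => \sum_(j < d) h 0 j * 'D_(delta_mx 0 j) f y).
  apply/funext => y; rewrite derive_inner // /inner.
  by apply: eq_bigr => j _; rewrite mxE mulrC.
by rewrite iter_derive_sum // => j; apply: dvf.
Qed.

(** By [nabla_diagS] the diagonal value is a polynomial in the coordinates of
the direction. *)
Lemma differentiable_nabla_diag (i : nat) f x h : times_differentiable i f ->
  differentiable (nabla_diag i f x) h.
Proof.
elim: i f => [|i IH] f tdf; first exact: differentiable_cst.
have -> : nabla_diag i.+1 f x =
    \sum_(j < d) ((fun h : 'rV[R]_d => h 0 j)
       * nabla_diag i ('D_(delta_mx 0 j) f) x).
  by apply/funext => k; rewrite nabla_diagS // fct_sumE.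
apply: differentiable_sum => j; apply: differentiableM.
  exact: differentiable_coord.
by apply: IH; case: tdf => _; apply.
Qed.

Lemma differentiable_taylor (q : nat) f x y : times_differentiable q f ->
  differentiable (fun y => taylor q f y x) y.
Proof.
move=> tdf; rewrite /taylor.
apply: (@differentiableD _ _ _ (cst (f x))); first exact: differentiable_cst.
have -> : (fun y => \sum_(1 <= i < q.+1) (i`!%:R)^-1 * nabla_diag i f x (y - x))
  = \sum_(1 <= i < q.+1) ((i`!%:R)^-1 *: (nabla_diag i f x \o (fun y => y - x))).
  by apply/funext => z; rewrite fct_sumE.
rewrite big_nat; apply: (@big_ind _ (fun g : 'rV[R]_d -> R => differentiable g y)).
- exact: differentiable_cst.
- by move=> g1 g2 d1 d2; apply: differentiableD.
move=> i /andP[_ iq]; apply: differentiableZ; apply: differentiable_comp.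
  by apply: differentiableB => //; exact: differentiable_cst.
by apply: differentiable_nabla_diag; apply: times_differentiable_le tdf.
Qed.

Lemma is_derive_line f x v : differentiable f x ->
  is_derive (0 : R) (1 : R) (fun t : R => f (t *: v + x)) ('D_v f x).
Proof.
move=> df; split.
  by have [h _] := derivable1P f x v; apply: h; exact: diff_derivable.
rewrite /derive; set g1 := fun h : R => h^-1 *: _; set g2 := fun h : R => h^-1 *: _.
suff -> : g1 = g2 by [].
by rewrite /g1 /g2; apply/funext => t /=; rewrite addr0 scale0r add0r [_%:A]mulr1.
Qed.

Lemma derivable_line f v x (t : R) : (forall y, differentiable f y) ->
  derivable (fun t : R => f (t *: v + x)) t 1.
Proof.
move=> df; apply/derivable1_diffP; apply: differentiable_comp => //.
Qed.

(** The s-th power of the norm is [S^(s/p)] with [S] the sum of p-th powers.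
As both exponents exceed [1], the chain rule holds even where [S] vanishes. *)
Lemma is_derive_pnorm_line (p : R) (s : nat) w (i : 'I_d) (t : R) :
  2 <= p -> p < s%:R ->
  is_derive t (1 : R) (fun t : R => pnorm p (t *: delta_mx 0 i + w) ^+ s)
    (s%:R * pnorm p (t *: delta_mx 0 i + w) `^ (s%:R - p)
      * spow (p - 1) (t + w 0 i)).
Proof.
move=> p2 ps; have p0 : 0 < p by lra.
have pn0 : p != 0 by rewrite gt_eqF.
have p1 : 1 < p by lra.
have a1 : 1 < s%:R / p by rewrite ltr_pdivlMr // mul1r.
pose S0 := \sum_(j < d | j != i) `|w 0 j| `^ p.
have E (u : R) : pnorm p (u *: delta_mx 0 i + w) `^ p = `|u + w 0 i| `^ p + S0.
  rewrite pnorm_powR // (bigD1 i) //= !mxE !eqxx mulr1; congr (_ + _).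
  apply: eq_bigr => j ji; rewrite !mxE eqxx (negPf ji) /= mulr0 add0r //.
have -> : (fun t : R => pnorm p (t *: delta_mx 0 i + w) ^+ s) =
   (fun y : R => `|y| `^ (s%:R / p)) \o
   (fun t : R => `|t + w 0 i| `^ p + S0).
  apply/funext => u /=; rewrite -E ger0_norm ?powR_ge0 // -powRrM mulrCA.
  by rewrite divff // mulr1 powR_mulrn // pnorm_ge0.
have d1 := is_derive_abs_powR (`|t + w 0 i| `^ p + S0) a1.
have d2 : is_derive t (1 : R) (fun t : R => `|t + w 0 i| `^ p + S0)
   (p * spow (p - 1) (t + w 0 i)).
  have d3 := is_derive_abs_powR (t + w 0 i) p1.
  have d4 : is_derive t (1 : R) (fun t : R => t + w 0 i) 1.
    have := is_deriveD (is_derive_id t (1 : R)) (is_derive_cst (w 0 i) t (1 : R)).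
    by rewrite addr0.
  have d5 := @is_derive1_comp R _ (fun t : R => t + w 0 i) t _ _ d3 d4.
  have := is_deriveD d5 (is_derive_cst S0 t (1 : R)).
  by rewrite addr0 mulr1.
apply: (is_derive_eq (@is_derive1_comp R _ (fun t : R => `|t + w 0 i| `^ p + S0) t _ _ d1 d2)).
rewrite -E; move: (pnorm_ge0 p (t *: delta_mx 0 i + w)).
move: (pnorm _ _) (spow _ (t + _)) => r J r0.
have -> : spow (s%:R / p - 1) (r `^ p) = r `^ (s%:R - p).
  rewrite /spow ger0_norm ?powR_ge0 // -powRrM.
  have -> : p * (s%:R / p - 1) = s%:R - p by field.
  have [->|rn] := eqVneq r 0; first by rewrite powR0 // sgr0 mul0r powR0 // gt_eqF ?subr_gt0.
  by rewrite gtr0_sg ?mul1r // powR_gt0 // lt_neqAle eq_sym rn.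
by field.
Qed.

(** Along each coordinate line the model has a minimum at [x], so that its
derivative there is zero. *)
Lemma taylor_model_stationary (p : R) (s : nat) (M : R) f c x :
  2 <= p -> p < s%:R -> times_differentiable s.-1 f ->
  (forall y, taylor s.-1 f x c + M * pnorm p (x - c) ^+ s
          <= taylor s.-1 f y c + M * pnorm p (y - c) ^+ s) ->
  grad (fun y => taylor s.-1 f y c) x
    = - ((M * s%:R * pnorm p (x - c) `^ (s%:R - p)) *: dual_map p (x - c)).
Proof.
move=> p2 ps tdf xmin; apply/rowP => i; rewrite !mxE.
pose e : 'rV[R]_d := delta_mx 0 i.
pose T y := taylor s.-1 f y c.
have dT y : differentiable T y by exact: differentiable_taylor.
pose phi (t : R) := T (t *: e + x) + M * pnorm p (t *: e + (x - c)) ^+ s.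
have dphi (t D : R) : is_derive t (1 : R) (fun t => T (t *: e + x)) D ->
    is_derive t (1 : R) phi (D + M * (s%:R * pnorm p (t *: e + (x - c)) `^ (s%:R - p)
      * spow (p - 1) (t + (x - c) 0 i))).
  move=> dD; apply: is_deriveD.
  exact: is_deriveZ (is_derive_pnorm_line (x - c) i t p2 ps).
have : is_derive (0 : R) (1 : R) phi 0.
  apply: (@derive1_at_min _ _ (-1) 1); first lra.
  - move=> t _; apply: (@ex_derive _ _ _ _ _ _ _ (dphi t _ _)).
    by apply: derivableP; exact: derivable_line.
  - by rewrite in_itv /=; apply/andP; split; lra.
  move=> t _; rewrite /phi /T !scale0r !add0r addrA; exact: xmin.
have d0 := dphi 0 _ (is_derive_line e (dT x)).
move=> [_]; rewrite (@derive_val _ _ _ _ _ _ _ d0) scale0r !add0r !mxE => h.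
apply/eqP; rewrite -subr_eq0 opprK; apply/eqP; rewrite -[RHS]h.
by rewrite /T /e; ring.
Qed.

End Taylor.

(** The gradient of [f] at [x] is [- gamma] times the dual vector of [x - y],
plus an error of conjugate norm at most [gamma / s * r^(p-1)]. *)
Lemma taylor_step_gms (R : realType) (d : nat) (p sigma L : R) (s : nat)
    (f : 'rV[R]_d -> R) (x y : 'rV[R]_d)
    (gamma := s%:R * L / (s.-1)`!%:R * pnorm p (x - y) `^ (s%:R - p)) :
  2 <= p -> p < s%:R -> s%:R^-1 <= sigma -> 0 <= L -> smooth p s.-1 L f ->
  (forall z, taylor s.-1 f x y + L / (s.-1)`!%:R * lpnorm p (x - y) ^+ s
          <= taylor s.-1 f z y + L / (s.-1)`!%:R * lpnorm p (z - y) ^+ s) ->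
  [/\ 0 <= gamma,
      inner (grad f x) (x - y)
        <= - ((1 - sigma) * gamma * pnorm p (x - y) `^ p)
    & pnorm (conj_exponent p) (grad f x)
        <= (1 + sigma) * gamma * pnorm p (x - y) `^ (p - 1)].
Proof.
move=> p2 ps ssig L0 [tdf sm] xmin.
have p1 : 1 < p by lra. have p0 : 0 < p by lra.
have s0 : 0 < s%:R :> R by apply: lt_trans ps.
have g0 : 0 <= gamma.
  by rewrite /gamma !mulr_ge0 ?powR_ge0 ?invr_ge0 ?ler0n // ltW.
have xm z : taylor s.-1 f x y + L / (s.-1)`!%:R * pnorm p (x - y) ^+ s
          <= taylor s.-1 f z y + L / (s.-1)`!%:R * pnorm p (z - y) ^+ s.
  by rewrite -!pnormE.
have gT := taylor_model_stationary p2 ps tdf xm.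
have {sm} := sm y x; rewrite !pnormE.
set e := grad f x - _ => he.
have gE : grad f x = e - gamma *: dual_map p (x - y).
  by rewrite /e gT opprK /gamma; apply/rowP=> i; rewrite !mxE; ring.
have r0 := pnorm_ge0 p (x - y).
have nJ := pnorm_dual_map (x - y) p1.
have iJ := inner_dual_map (x - y) p0.
have hh := lp_holder e (x - y) p1.
have tri : pnorm (conj_exponent p) (grad f x)
    <= pnorm (conj_exponent p) e + gamma * pnorm p (x - y) `^ (p - 1).
  rewrite gE; apply: le_trans (pnorm_conjD _ _ p1) _.
  have [q0 _ _ _] := conj_exponent_spec p1.
  by rewrite pnormN // pnormZ // nJ ger0_norm.
have ig : inner (grad f x) (x - y)
    = inner e (x - y) - gamma * pnorm p (x - y) `^ p.
  by rewrite gE innerDl -scaleNr innerZl iJ mulNr.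
have fe : L / (s.-1)`!%:R * pnorm p (x - y) ^+ s.-1
    = gamma / s%:R * pnorm p (x - y) `^ (p - 1).
  rewrite /gamma; move: r0; move: (pnorm p (x - y)) => r r0.
  have s1 : (s = s.-1.+1)%N by case: (s) s0 => //; rewrite ltxx.
  have s1R : (s.-1)%:R = s%:R - 1 :> R by rewrite {2}s1 -natr1 addrK.
  rewrite -powR_mulrn // s1R.
  have -> : s%:R - 1 = (s%:R - p) + (p - 1) by ring.
  rewrite (@powRD _ r (s%:R - p) (p - 1)); last by apply/implyP => /eqP; lra.
  have fz : (s.-1)`!%:R != 0 :> R by rewrite pnatr_eq0 -lt0n fact_gt0.
  by field; rewrite fz gt_eqF.
rewrite fe in he; clear xmin xm gT gE nJ iJ fe.
move: he hh tri ig r0 g0.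
move: (pnorm (conj_exponent p) e) (pnorm (conj_exponent p) (grad f x)) => E G.
move: (inner _ _) (inner _ _) gamma => Ig Ie g he hh tri ig r0 g0.
have rp : pnorm p (x - y) `^ p = pnorm p (x - y) * pnorm p (x - y) `^ (p - 1).
  by rewrite mulr_powRB1.
rewrite rp in ig *.
have := powR_ge0 (pnorm p (x - y)) (p - 1).
move: r0 he hh tri ig {rp}; move: (pnorm p (x - y)) => r.
move: (r `^ (p - 1)) => P r0 he hh tri ig P0.
have gs : g / s%:R * P <= sigma * g * P.
  by rewrite ler_wpM2r // mulrC ler_wpM2r.
split => //; last by lra.
have : E * r <= g / s%:R * P * r by rewrite ler_wpM2r.
have : g / s%:R * P * r <= sigma * g * P * r by rewrite ler_wpM2r.
lra.
Qed.

(** * Prox centers and one accelerated step *)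

Lemma spow_spowV (R : realType) (a x : R) : a != 0 -> spow a (spow a^-1 x) = x.
Proof.
move=> a0; have [->|xn] := eqVneq x 0.
  by rewrite /spow sgr0 mul0r sgr0 mul0r.
have n0 : 0 < `|x| by rewrite normr_gt0.
rewrite {1}/spow norm_spow ?invr_eq0 // -powRrM mulVf // powRr1 //.
by rewrite /spow sgrM (gtr0_sg (powR_gt0 _ n0)) mulr1 sgr_id -numEsg.
Qed.

Lemma spowN (R : realType) (a x : R) : spow a (- x) = - spow a x.
Proof. by rewrite /spow sgrN normrN mulNr. Qed.

Section Prox.
Variables (R : realType) (d : nat).
Implicit Types (x y z G : 'rV[R]_d).

(** The minimizer of [inner G z] plus the p-th power of the distance to [x0]:
the problem is separable and each coordinate solves
[p * spow (p - 1) (z - x0) = - G]. *)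
Definition prox_center (p : R) x0 G : 'rV[R]_d :=
  x0 - \row_i spow (p - 1)^-1 (G 0 i / p).

(** Uniform convexity in each coordinate, at the point where the linear term
cancels the derivative. *)
Lemma prox_center_growth (p : R) x0 G z : 2 <= p ->
  inner G (prox_center p x0 G) + pnorm p (prox_center p x0 G - x0) `^ p
    + 2 * pnorm p (2^-1 *: (z - prox_center p x0 G)) `^ p
  <= inner G z + pnorm p (z - x0) `^ p.
Proof.
move=> p2; have p0 : p != 0 by rewrite gt_eqF //; lra.
have p1 : p - 1 != 0 by rewrite gt_eqF //; lra.
rewrite !pnorm_powR // /inner mulr_sumr -!big_split /=.
apply: ler_sum => i _; rewrite !mxE.
set u := spow _ _.
have := powR_uniformly_convex (- u) (z 0 i - x0 0 i) p2.
rewrite spowN spow_spowV //.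
have -> : p * - (G 0 i / p) = - G 0 i by field.
have -> : x0 0 i - u - x0 0 i = - u by ring.
have -> : 2^-1 * (z 0 i - (x0 0 i - u)) = (z 0 i - x0 0 i - - u) / 2 by field.
lra.
Qed.

Lemma prox_center_unique (p : R) x0 G z1 : 2 <= p ->
  (forall z, inner G z1 + pnorm p (z1 - x0) `^ p
          <= inner G z + pnorm p (z - x0) `^ p) ->
  z1 = prox_center p x0 G.
Proof.
move=> p2 zmin; have p0 : 0 < p by lra.
have h1 := prox_center_growth x0 G z1 p2.
have h2 := zmin (prox_center p x0 G).
have : pnorm p (2^-1 *: (z1 - prox_center p x0 G)) `^ p <= 0 by lra.
rewrite le_eqVlt ltNge powR_ge0 orbF => /eqP /powR_eq0_eq0 /(pnorm_eq0 p0) h.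
apply/eqP; rewrite -subr_eq0; apply/eqP.
have /eqP := h; rewrite scaler_eq0 invr_eq0 pnatr_eq0 /= => /eqP //.
Qed.

End Prox.

(** If [a m W] is at most [theta A' r], the first term on the right suffices.
Otherwise [r] is at most a multiple of [W], and the hypothesis bounds the left
side by [W^p]. *)
Lemma step_size_young (R : realType) (p theta b l a m A' r W : R) :
  1 < p -> 0 < theta <= 1 -> 0 < a -> 0 < m -> 0 < A' -> 0 <= l -> 0 <= b ->
  0 <= r -> 0 <= W ->
  b * l * (m / theta * a) `^ p <= A' `^ (p - 1) ->
  b * l * (a * m) * r `^ (p - 1) * W <= theta * (b * l) * A' * r `^ p + W `^ p.
Proof.
move=> p1 /andP[th0 th1] a0 m0 A0 l0 b0 r0 W0.
move: (mulr_ge0 b0 l0); move: (b * l) => k k0 hk.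
have p0 : 0 < p by lra.
have am0 : 0 < a * m by exact: mulr_gt0.
have tA0 : 0 < theta * A' by exact: mulr_gt0.
have P0 := powR_ge0 r (p - 1).
have [h|h] := leP (a * m * W) (theta * A' * r).
  have : k * (r `^ (p - 1)) * (a * m * W) <= k * (r `^ (p - 1)) * (theta * A' * r).
    by rewrite ler_wpM2l // mulr_ge0.
  have := powR_ge0 W p; rewrite -(mulr_powRB1 r0 p0); lra.
have : (theta * A' * r) `^ (p - 1) <= (a * m * W) `^ (p - 1).
  apply: ge0_ler_powR; last exact: ltW.
  - by rewrite subr_ge0 ltW.
  - by rewrite nnegrE (mulr_ge0 (ltW tA0)).
  - by rewrite nnegrE (mulr_ge0 (ltW am0)).
rewrite !(powRM _ (ltW tA0)) // (powRM _ (ltW am0)) // => h1.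
have Q : k * (a * m) `^ p <= (theta * A') `^ (p - 1).
  have e : m / theta * a = (a * m) / theta by rewrite mulrC mulrA.
  have ti0 : 0 <= theta^-1 by rewrite invr_ge0 ltW.
  move: hk; rewrite e powRM ?(ltW am0) // (powRM _ (ltW th0) (ltW A0)).
  have tp : 0 < theta `^ (p - 1) by exact: powR_gt0.
  have tt : theta `^ p <= theta `^ (p - 1).
    by apply: ger_powR; [apply/andP|lra].
  have tpp : 0 < theta `^ p by exact: powR_gt0.
  have -> : theta^-1 `^ p = (theta `^ p)^-1.
    by rewrite -powR_inv1 ?ltW // -powRrM mulN1r powRN.
  rewrite mulrA ler_pdivrMr // => hk; apply: (le_trans hk).
  by rewrite mulrC ler_wpM2r // powR_ge0.
have T0 : 0 < (theta * A') `^ (p - 1) by exact: powR_gt0.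
have WW := mulr_powRB1 W0 p0.
have e2 := mulr_powRB1 (ltW am0) p0.
rewrite -(ler_pM2l T0).
have V0 := powR_ge0 W (p - 1).
have : k * (a * m) * W * ((theta * A') `^ (p - 1) * r `^ (p - 1))
    <= k * (a * m) * W * ((a * m) `^ (p - 1) * W `^ (p - 1)).
  by rewrite ler_wpM2l // !mulr_ge0 // ltW.
have -> : k * (a * m) * W * ((a * m) `^ (p - 1) * W `^ (p - 1))
   = k * (a * m) `^ p * W `^ p by rewrite -e2 -WW; ring.
have := ler_wpM2r (powR_ge0 W p) Q.
have : 0 <= (theta * A') `^ (p - 1) * (theta * k * A' * r `^ p).
  by rewrite !mulr_ge0 ?powR_ge0 // ltW.
lra.
Qed.

(** The combination of the gradient inequalities at [x'] leaves the inner
product of the gradient with [A' (y - x') + a (z - zt)], because [y] is the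
average of [x] and [zt] with weights [A] and [a].  The first part is the progress
of the proximal step, and [step_size_young] absorbs the second one. *)
Lemma accelerated_step (R : realType) (d : nat) (p sigma : R)
    (f : 'rV[R]_d -> R) (a A beta lam lambar : R) (x zt x' xn y z : 'rV[R]_d)
    (A' := A + a) :
  2 <= p -> 0 <= sigma < 1 ->
  convex_function [set: 'rV[R]_d] f -> (forall u, differentiable f u) ->
  0 <= A -> 0 < a -> 0 < beta <= 1 -> 0 <= lam -> beta * lam <= lambar ->
  lambar * (step_coef sigma * a) `^ p = A' `^ (p - 1) ->
  y = (A / A') *: x + (a / A') *: zt ->
  inner (grad f x') (x' - y) <= - ((1 - sigma) * lam * pnorm p (x' - y) `^ p) ->
  pnorm (conj_exponent p) (grad f x')
    <= (1 + sigma) * lam * pnorm p (x' - y) `^ (p - 1) ->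
  xn = (A + beta * a)^-1 *: (((1 - beta) * A) *: x + (beta * A') *: x') ->
  (A + beta * a) * f xn
    + (1 - sigma) / 3 * (A' * beta * lam * pnorm p (x' - y) `^ p)
  <= A * f x + 2 * pnorm p (2^-1 *: (z - zt)) `^ p
     + a * beta * (f x' + inner (grad f x') (z - x')).
Proof.
move=> p2 /andP[s0 s1] cf df A0 a0 /andP[b0 b1] l0 bl ha ey hi hn exn.
have p1 : 1 < p by lra. have p0 : 0 < p by lra.
have A'0 : 0 < A' by rewrite /A'; lra.
have Ab0 : 0 < A + beta * a by have := mulr_gt0 b0 a0; lra.
have jensen : (A + beta * a) * f xn <= (1 - beta) * A * f x + beta * A' * f x'.
  have h1 := convex_gradient x cf (df xn).
  have h2 := convex_gradient x' cf (df xn).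
  have e : (1 - beta) * A * inner (grad f xn) (x - xn)
      + beta * A' * inner (grad f xn) (x' - xn) = 0.
    rewrite -!innerZr -innerDr.
    rewrite [X in inner _ X](_ : _ = 0) ?inner0r //.
    apply/eqP; rewrite !scalerBr addrACA -opprD -scalerDl subr_eq0; apply/eqP.
    rewrite {1}(_ : ((1 - beta) * A) *: x + (beta * A') *: x'
      = (A + beta * a) *: xn); first by congr (_ *: _); rewrite /A'; ring.
    by rewrite exn scalerA divff ?gt_eqF // scale1r.
  have c1 : 0 <= (1 - beta) * A by rewrite mulr_ge0 // subr_ge0.
  have c2 : 0 <= beta * A' by rewrite mulr_ge0 // ltW.
  have := ler_wpM2l c1 h1; have := ler_wpM2l c2 h2.
  have -> : (A + beta * a) * f xn = (1 - beta) * A * f xn + beta * A' * f xn.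
    by rewrite /A'; ring.
  lra.
have h1 := convex_gradient x cf (df x').
have split_lin : A * inner (grad f x') (x - x') + a * inner (grad f x') (z - x')
   = - (A' * inner (grad f x') (x' - y))
     + 2 * a * inner (grad f x') (2^-1 *: (z - zt)).
  rewrite -!innerZr -innerNr -!innerDr; congr inner.
  have A'n : A' != 0 by rewrite gt_eqF.
  rewrite ey; apply/rowP => i; rewrite !mxE /A'.
  by field; move: A'n; rewrite /A'.
have hl : - (2 * ((1 + sigma) * lam * pnorm p (x' - y) `^ (p - 1)
      * pnorm p (2^-1 *: (z - zt))))
    <= 2 * inner (grad f x') (2^-1 *: (z - zt)).
  have := lp_holder (grad f x') (- (2^-1 *: (z - zt))) p1.
  rewrite innerNr pnormN // => hh.
  have := ler_wpM2r (pnorm_ge0 p (2^-1 *: (z - zt))) hn.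
  lra.
have th : 0 < (1 - sigma) / 3 <= 1 by apply/andP; split; lra.
have yg : beta * lam * ((1 + sigma) / ((1 - sigma) / 3) * a) `^ p <= A' `^ (p - 1).
  rewrite -ha /step_coef.
  have -> : (1 + sigma) / ((1 - sigma) / 3) = (3 + 3 * sigma) / (1 - sigma).
    by field; rewrite subr_eq0 gt_eqF.
  by rewrite ler_wpM2r // powR_ge0.
have m0 : 0 < 1 + sigma by lra.
have := step_size_young p1 th a0 m0 A'0 l0 (ltW b0) (pnorm_ge0 p (x' - y))
  (pnorm_ge0 p (2^-1 *: (z - zt))) yg.
have := ler_wpM2l (mulr_ge0 (ltW b0) A0) h1.
have := ler_wpM2l (mulr_ge0 (ltW b0) (ltW A'0)) hi.
have := ler_wpM2l (mulr_ge0 (ltW b0) (ltW a0)) hl.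
have := congr1 (fun u => beta * u) split_lin.
move: jensen.
move: (f xn) (f x) (f x') (inner (grad f x') (x - x')) (inner (grad f x') (z - x')).
move: (inner (grad f x') (x' - y)) (inner (grad f x') (2^-1 *: (z - zt))).
move: (pnorm p (2^-1 *: (z - zt))) (pnorm p (x' - y)) => W r.
move: (r `^ p) (r `^ (p - 1)) (W `^ p) => rp r1 Wp.
rewrite /A' {A'0 ha yg ey exn hi hn hl split_lin h1 cf df Ab0}.
clear A'.
move=> Ig I2 Fn Fx Fx' Ix Iz jensen e h3 h2 h1 hY.
lra.
Qed.

(** * The potential along a run *)

Lemma lambar_rule_ge0 (R : realType) (p : R) (s : nat) (mu Rad Aref : R) :
  0 <= lambar_rule p s mu Rad Aref.
Proof. by rewrite /lambar_rule !mulr_ge0 // powR_ge0. Qed.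

Section Run.
Variables (R : realType) (d : nat) (p : R) (s : nat) (sigma mu Rad : R).
Variables (f : 'rV[R]_d -> R) (O : 'rV[R]_d -> 'rV[R]_d * R) (x0 : 'rV[R]_d).
Variables (T : nat) (tr : trace R d).
Hypotheses (p2 : 2 <= p) (sigma01 : 0 <= sigma < 1).
Hypothesis gms : gms_oracle p sigma f O.
Hypothesis tr_run : gppa_run p s sigma mu Rad f O x0 T tr.

Lemma step_coef_gt0 : 0 < step_coef sigma.
Proof. by have /andP[? ?] := sigma01; rewrite /step_coef divr_gt0 //; lra. Qed.

Lemma run_gms t : (t < T)%N ->
  [/\ 0 <= lam tr t.+1,
      inner (grad f (iterx' tr t.+1)) (iterx' tr t.+1 - itery tr t)
        <= - ((1 - sigma) * lam tr t.+1
               * pnorm p (iterx' tr t.+1 - itery tr t) `^ p)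
    & pnorm (conj_exponent p) (grad f (iterx' tr t.+1))
        <= (1 + sigma) * lam tr t.+1
           * pnorm p (iterx' tr t.+1 - itery tr t) `^ (p - 1)].
Proof.
move=> tT; have [_ _ _ _ /(_ t tT) it] := tr_run.
by have := gms (itery tr t); rewrite -(gppa_oracle it) !pnormE.
Qed.

Lemma run_lambar_ge0 t : (t < T)%N -> 0 <= lambar tr t.+1.
Proof.
move=> tT; have [_ _ _ _ /(_ t tT) it] := tr_run.
rewrite (gppa_lambar it); case: ifP => _; [exact: ler01|exact: lambar_rule_ge0].
Qed.

Lemma run_beta_ge0 t : (t < T)%N -> 0 <= beta tr t.+1.
Proof.
move=> tT; have [_ _ _ _ /(_ t tT) it] := tr_run.
have [l0 _ _] := run_gms tT.
rewrite (gppa_beta it); case: ifP => _ //.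
by rewrite le_min ler01 divr_ge0 // run_lambar_ge0.
Qed.

Lemma run_sumA_ge0 t : (t <= T)%N -> 0 <= sumA tr t.
Proof.
elim: t => [|t IH] tT; first by have [-> _ _ _ _] := tr_run.
have [_ _ _ _ /(_ t tT) it] := tr_run.
rewrite (gppa_A it) addr_ge0 ?IH 1?ltnW // mulr_ge0 ?run_beta_ge0 //.
exact: ltW (gppa_stepa_gt0 it).
Qed.

Lemma run_lambar_gt0 t : (t < T)%N -> 0 < lambar tr t.+1.
Proof.
move=> tT; have [_ _ _ _ /(_ t tT) it] := tr_run.
rewrite lt_neqAle run_lambar_ge0 // andbT; apply/eqP => l0.
have := gppa_stepa it; rewrite -l0 mul0r => /esym /powR_eq0_eq0.
by have := run_sumA_ge0 (ltnW tT); have := gppa_stepa_gt0 it; lra.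
Qed.

Lemma run_beta t : (t < T)%N ->
  0 < beta tr t.+1 <= 1 /\ beta tr t.+1 * lam tr t.+1 <= lambar tr t.+1.
Proof.
move=> tT; have [_ _ _ _ /(_ t tT) it] := tr_run.
have [l0 _ _] := run_gms tT; have lb0 := run_lambar_gt0 tT.
rewrite (gppa_beta it); have [e|ln0] := eqVneq (lam tr t.+1) 0.
  by rewrite e mulr0 (ltW lb0) ltr01 lexx.
have {}l0 : 0 < lam tr t.+1 by rewrite lt_neqAle eq_sym ln0.
split; first by rewrite lt_min ltr01 divr_gt0 //= ge_min lexx.
by rewrite -ler_pdivlMr // ge_min lexx orbT.
Qed.

Lemma run_beta_lt1 t : (t < T)%N -> beta tr t.+1 != 1 ->
  beta tr t.+1 * lam tr t.+1 = lambar tr t.+1 /\ lambar tr t.+1 < lam tr t.+1.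
Proof.
move=> tT; have [_ _ _ _ /(_ t tT) it] := tr_run.
have [l0 _ _] := run_gms tT.
rewrite (gppa_beta it); have [e|ln0] := eqVneq (lam tr t.+1) 0.
  by rewrite eqxx.
have {}l0 : 0 < lam tr t.+1 by rewrite lt_neqAle eq_sym ln0.
rewrite minEle; case: (leP 1 (_ / _)) => [_|h _]; first by rewrite eqxx.
by rewrite divfK ?gt_eqF // -[ltRHS]mul1r -ltr_pdivrMr.
Qed.

Lemma run_sumA_lt t : (t < T)%N -> sumA tr t < sumA tr t.+1.
Proof.
move=> tT; have [_ _ _ _ /(_ t tT) it] := tr_run.
have [/andP[b0 _] _] := run_beta tT.
by rewrite (gppa_A it) ltrDl mulr_gt0 // (gppa_stepa_gt0 it).
Qed.

Lemma run_sumA_gt0 t : (0 < t <= T)%N -> 0 < sumA tr t.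
Proof.
case: t => // t tT; apply: le_lt_trans (run_sumA_lt tT).
exact/run_sumA_ge0/ltnW.
Qed.

(** The total progress of the proximal steps, summed with the weights with
which it enters the potential. *)
Definition movement_gain (t : nat) : R :=
  \sum_(1 <= i < t.+1) (sumA tr i.-1 + stepa tr i) * beta tr i * lam tr i
     * pnorm p (iterx' tr i - itery tr i.-1) `^ p.

(** The estimate sequence of the accelerated method, whose minimizer is
[iterz tr t]. *)
Definition estimate (t : nat) (z : 'rV[R]_d) : R :=
  \sum_(1 <= i < t.+1) stepa tr i * beta tr i
     * (f (iterx' tr i) + inner (grad f (iterx' tr i)) (z - iterx' tr i))
  + pnorm p (z - x0) `^ p.

Lemma inner_grad_sum t z : inner (grad_sum f tr t) z =
  \sum_(1 <= i < t.+1) stepa tr i * beta tr i * inner (grad f (iterx' tr i)) z.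
Proof. by rewrite /grad_sum inner_suml; apply: eq_bigr => i _; rewrite innerZl. Qed.

Lemma run_iterz t : (t <= T)%N ->
  iterz tr t = prox_center p x0 (grad_sum f tr t).
Proof.
have p0 : 0 < p by apply: lt_le_trans p2.
case: t => [_|t tT].
  have [_ _ -> _ _] := tr_run; rewrite /grad_sum big_geq //.
  apply/rowP => i; rewrite !mxE mul0r /spow sgr0 mul0r subr0 //.
have [_ _ _ _ /(_ t tT) it] := tr_run.
apply: prox_center_unique => // z.
by have := gppa_z it z; rewrite !inner_grad_sum !pnormE.
Qed.

(** Up to a constant the estimate is the function minimized by the prox center
of the accumulated gradients. *)
Lemma estimate_growth t z : (t <= T)%N ->
  estimate t (iterz tr t) + 2 * pnorm p (2^-1 *: (z - iterz tr t)) `^ p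
    <= estimate t z.
Proof.
move=> tT; have := prox_center_growth x0 (grad_sum f tr t) z p2.
rewrite -run_iterz // !inner_grad_sum /estimate.
have E u : \sum_(1 <= i < t.+1) stepa tr i * beta tr i
     * (f (iterx' tr i) + inner (grad f (iterx' tr i)) (u - iterx' tr i))
   = \sum_(1 <= i < t.+1) stepa tr i * beta tr i * inner (grad f (iterx' tr i)) u
   + \sum_(1 <= i < t.+1) stepa tr i * beta tr i
     * (f (iterx' tr i) - inner (grad f (iterx' tr i)) (iterx' tr i)).
  by rewrite -big_split /=; apply: eq_bigr => i _; rewrite innerBr; ring.
rewrite !E; lra.
Qed.

Hypothesis cvx : convex_function [set: 'rV[R]_d] f.
Hypothesis dif : forall x, differentiable f x.

(** At the minimizer of the next estimate, [accelerated_step] turns the bound for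
[t] into the one for [t + 1]; the growth of the estimate away from its minimizer
extends it to all [z]. *)
Lemma potential t z : (t <= T)%N ->
  sumA tr t * f (iterx tr t) + (1 - sigma) / 3 * movement_gain t
    + 2 * pnorm p (2^-1 *: (z - iterz tr t)) `^ p <= estimate t z.
Proof.
elim: t z => [|t IH] z tT.
  have [-> -> -> _ _] := tr_run.
  rewrite /movement_gain /estimate !big_geq // mul0r mulr0 !add0r.
  have p0 : 0 < p by apply: lt_le_trans p2.
  rewrite pnormZ // powRM ?pnorm_ge0 // ger0_norm ?invr_ge0 //.
  have h2 : 2 * 2^-1 `^ p <= 1 :> R.
    rewrite -ler_pdivlMl // mulr1 -[leRHS]powRr1 ?invr_ge0 //.
    by apply: ger_powR; [apply/andP; split|]; have := p2; lra.
  have := ler_wpM2r (powR_ge0 (pnorm p (z - x0)) p) h2.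
  rewrite mul1r; lra.
apply: le_trans (estimate_growth _ tT); rewrite lerD2r.
have [_ _ _ _ /(_ t tT) it] := tr_run.
have [l0 hi hn] := run_gms tT; have [b01 bl] := run_beta tT.
have := accelerated_step (iterz tr t.+1) p2 sigma01 cvx dif (run_sumA_ge0 (ltnW tT))
  (gppa_stepa_gt0 it) b01 l0 bl (gppa_stepa it) (gppa_y it) hi hn (gppa_x it).
have := IH (iterz tr t.+1) (ltnW tT).
rewrite /movement_gain /estimate !(big_nat_recr t.+1) //= -(gppa_A it); lra.
Qed.

(** By convexity, each term of the sum in the estimate at [w] is at most its
weight times [f w]. *)
Lemma run_value_bound t w : (t <= T)%N ->
  sumA tr t * (f (iterx tr t) - f w) + (1 - sigma) / 3 * movement_gain t
    <= pnorm p (w - x0) `^ p.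
Proof.
move=> tT; have := potential w tT; rewrite /estimate.
have SA : sumA tr t = \sum_(1 <= i < t.+1) stepa tr i * beta tr i.
  elim: t tT => [|t IH] tT; first by rewrite big_geq //; have [-> _ _ _ _] := tr_run.
  have [_ _ _ _ /(_ t tT) it] := tr_run.
  by rewrite (gppa_A it) big_nat_recr //= -IH 1?ltnW // mulrC.
have : \sum_(1 <= i < t.+1) stepa tr i * beta tr i
     * (f (iterx' tr i) + inner (grad f (iterx' tr i)) (w - iterx' tr i))
   <= sumA tr t * f w.
  rewrite SA mulr_suml !big_nat; apply: ler_sum => i /andP[i0 it].
  case: i i0 it => // i _ it; have iT : (i < T)%N by apply: leq_trans tT.
  have [_ _ _ _ /(_ i iT) iti] := tr_run.
  apply: ler_wpM2l; last exact: convex_gradient.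
  by rewrite mulr_ge0 ?run_beta_ge0 // ltW // (gppa_stepa_gt0 iti).
have := powR_ge0 (pnorm p (2^-1 *: (w - iterz tr t))) p.
move: (\sum_(_ <= _ < _) _) => S; lra.
Qed.

Lemma movement_gain_step t :
  movement_gain t.+1 = movement_gain t +
    (sumA tr t + stepa tr t.+1) * beta tr t.+1 * lam tr t.+1
     * pnorm p (iterx' tr t.+1 - itery tr t) `^ p.
Proof. by rewrite /movement_gain (big_nat_recr t.+1). Qed.

End Run.

(** * The rule for the step parameter *)

Lemma ln_inj_gt0 (R : realType) (x y : R) : 0 < x -> 0 < y -> ln x = ln y -> x = y.
Proof. by move=> x0 y0; apply: ln_inj. Qed.

Section LambarRule.
Variables (R : realType) (p : R) (s : nat) (mu Rad A : R).
Hypotheses (p2 : 2 <= p) (ps : p < s%:R) (mu0 : 0 < mu) (Rad0 : 0 < Rad).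
Hypothesis (A0 : 0 < A).

(** This is [1 / (s (1 + nu))] for [nu = 1/p - 1/s]. *)
Definition rate_exponent : R := p / (p * s%:R - p + s%:R).

(** The power of the weight that grows at least linearly with the number of
iterations. *)
Definition scaled_weight (B : R) : R :=
  (mu ^+ s * Rad `^ (s%:R - p) * B) `^ rate_exponent.

Lemma rate_denominator_gt0 : 0 < p * s%:R - p + s%:R.
Proof. by have := p2; have := ps; nra. Qed.

Lemma rate_exponent_gt0 : 0 < rate_exponent.
Proof. by rewrite divr_gt0 // ?rate_denominator_gt0 //; apply: lt_le_trans p2. Qed.

Lemma lambar_rule_gt0 : 0 < lambar_rule p s mu Rad A.
Proof. by rewrite /lambar_rule !mulr_gt0 // ?powR_gt0. Qed.

Lemma scaled_weight_gt0 B : 0 < B -> 0 < scaled_weight B.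
Proof. by move=> B0; rewrite powR_gt0 // !mulr_gt0 ?exprn_gt0 ?powR_gt0. Qed.

Lemma le_scaled_weight B C : 0 <= B -> B <= C -> scaled_weight B <= scaled_weight C.
Proof.
move=> B0 BC; have m0 : 0 <= mu ^+ s * Rad `^ (s%:R - p).
  by rewrite mulr_ge0 ?powR_ge0 // exprn_ge0 // ltW.
apply: ge0_ler_powR; rewrite ?nnegrE.
- exact/ltW/rate_exponent_gt0.
- exact: mulr_ge0.
- by apply: mulr_ge0 => //; apply: le_trans BC.
- exact: ler_wpM2l.
Qed.

(** The identities on [lambar_rule] below are identities between products of
real powers; in logarithms they are identities of rational functions. *)
Lemma ln_lambar_rule : ln (lambar_rule p s mu Rad A) =
  (- ((s%:R - p) * (p + 1) * ln A) + p * (s%:R - p) * (p * ln Rad)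
   + s%:R * p ^+ 2 * ln mu) / (p * s%:R - p + s%:R).
Proof.
rewrite /lambar_rule !lnM ?posrE ?mulr_gt0 ?powR_gt0 // !ln_powR.
by field; rewrite gt_eqF // rate_denominator_gt0.
Qed.

Lemma ln_scaled_weight : ln (scaled_weight A) =
  rate_exponent * (s%:R * ln mu + (s%:R - p) * ln Rad + ln A).
Proof.
rewrite /scaled_weight ln_powR !lnM ?posrE ?mulr_gt0 ?powR_gt0 ?exprn_gt0 //.
by rewrite lnXn // ln_powR mulr_natl.
Qed.

(** Controls the growth of the weight in an iteration with [beta = 1]. *)
Lemma mul_lambar_rule : A * lambar_rule p s mu Rad A = scaled_weight A `^ p.
Proof.
have l0 := lambar_rule_gt0; have w0 := scaled_weight_gt0 A0.
apply: ln_inj_gt0; [exact: mulr_gt0|exact: powR_gt0|].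
rewrite lnM ?posrE // ln_powR ln_lambar_rule ln_scaled_weight /rate_exponent.
by field; rewrite gt_eqF // rate_denominator_gt0.
Qed.

(** Controls the movement in an iteration with [beta < 1]: it is at least
[(lambar / mu^s)^(1/(s-p))]. *)
Lemma lambar_rule_movement :
  A * lambar_rule p s mu Rad A
    * (lambar_rule p s mu Rad A / mu ^+ s) `^ (p / (s%:R - p))
  = Rad `^ p / scaled_weight A.
Proof.
have l0 := lambar_rule_gt0; have w0 := scaled_weight_gt0 A0.
have m0 : 0 < mu ^+ s by exact: exprn_gt0.
have lm0 : 0 < lambar_rule p s mu Rad A / mu ^+ s by exact: divr_gt0.
have P0 := powR_gt0 (p / (s%:R - p)) lm0.
have R0 := powR_gt0 p Rad0.
have Al0 := mulr_gt0 A0 l0.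
apply: ln_inj_gt0; [exact: mulr_gt0|exact: divr_gt0|].
rewrite (lnM Al0 P0) (lnM A0 l0) !ln_powR (ln_div l0 m0) (ln_div R0 w0) ln_powR.
rewrite lnXn // ln_lambar_rule ln_scaled_weight /rate_exponent.
rewrite -[ln mu *+ s]mulr_natl.
by field; rewrite !gt_eqF ?rate_denominator_gt0 // subr_gt0.
Qed.

End LambarRule.

(** The exponential is at least its tangent at [0], and
[ln (1 + x) >= x / (1 + x)]. *)
Lemma powR_1p_lower (R : realType) (rho x : R) : 0 <= rho -> 0 <= x ->
  1 + rho * (x / (1 + x)) <= (1 + x) `^ rho.
Proof.
move=> r0 x0; have y0 : 0 < 1 + x by lra.
have -> : (1 + x) `^ rho = expR (rho * ln (1 + x)) by rewrite /powR gt_eqF.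
apply: le_trans (expR_ge1Dx _); rewrite lerD2l ler_wpM2l //.
have e : 1 + - x / (1 + x) = (1 + x)^-1 by field; rewrite gt_eqF.
have h : -1 < - x / (1 + x).
  by rewrite -subr_gt0 opprK addrC e invr_gt0.
have := le_ln1Dx h.
by rewrite e lnV ?posrE // lerNl mulNr opprK.
Qed.

Lemma powR_le_inv (R : realType) (p x y : R) : 0 < p -> 0 <= x -> 0 <= y ->
  x `^ p <= y `^ p -> x <= y.
Proof.
move=> p0 x0 y0; apply: contraLR; rewrite -!ltNge => yx.
by apply: gt0_ltr_powR; rewrite ?nnegrE.
Qed.

(** The equation for [a] reads [(c a u(Ar))^p = Ar (A + a)^(p-1)] after
multiplication by [Ar], so that [a] is at least [A / (2 c u A)].  The relative
increase of the weight is thus of order [1 / u A]. *)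
Lemma scaled_weight_increment (R : realType) (p c : R) (s : nat)
    (mu Rad A Ar a g : R) (delta := (2 * c)^-1)
    (u := @scaled_weight R p s mu Rad) :
  2 <= p -> p < s%:R -> 0 < mu -> 0 < Rad -> 0 < c ->
  0 < Ar -> Ar <= A -> A <= 2 * Ar -> 0 < a -> 0 < g -> g <= u A ->
  lambar_rule p s mu Rad Ar * (c * a) `^ p = (A + a) `^ (p - 1) ->
  u A + rate_exponent p s * (delta * g / (g + delta)) <= u (A + a).
Proof.
move=> p2 ps mu0 Rad0 c0 Ar0 ArA A2Ar a0 g0 gu ha.
have p0 : 0 < p by lra.
have A0 : 0 < A by lra.
have uA0 : 0 < u A by exact: scaled_weight_gt0.
have ur0 : 0 < u Ar by exact: scaled_weight_gt0.
have uru : u Ar <= u A.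
  exact: (le_scaled_weight Rad p2 ps mu0 (ltW Ar0) ArA).
have d0 : 0 < delta by rewrite invr_gt0; lra.
have ca0 : 0 < c * a by exact: mulr_gt0.
have e1 := mul_lambar_rule p2 ps mu0 Rad0 Ar0.
have big_a : A / 2 <= c * a * u Ar.
  apply: (powR_le_inv p0); [lra|by rewrite mulr_ge0 // ltW|].
  rewrite (powRM _ (ltW ca0) (ltW ur0)) -e1.
  have -> : (c * a) `^ p * (Ar * lambar_rule p s mu Rad Ar)
     = Ar * (lambar_rule p s mu Rad Ar * (c * a) `^ p) by ring.
  have A20 : 0 <= A / 2 by lra.
  rewrite ha -(mulr_powRB1 A20 p0); apply: ler_pM => //.
  - exact: powR_ge0.
  - by lra.
  - by apply: ge0_ler_powR; rewrite ?nnegrE; lra.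
have aA : A * (delta / u A) <= a.
  rewrite mulrA ler_pdivrMr // /delta.
  have -> : A / (2 * c) = (A / 2) / c by field; rewrite gt_eqF.
  rewrite ler_pdivrMr //; apply: (le_trans big_a).
  have : a * c * u Ar <= a * c * u A by rewrite ler_wpM2l // mulr_ge0 ?ltW.
  lra.
pose x := delta / u A.
have x0 : 0 <= x by rewrite divr_ge0 ?ltW.
have r0 := rate_exponent_gt0 p2 ps.
have h := powR_1p_lower (ltW r0) x0.
have uB : u A * (1 + x) `^ rate_exponent p s <= u (A + a).
  rewrite /u /scaled_weight -powRM; last 2 first.
  - by rewrite mulr_ge0 ?mulr_ge0 ?powR_ge0 ?exprn_ge0 // ltW.
  - by lra.
  rewrite -mulrA; apply: (le_scaled_weight Rad p2 ps mu0).
    by rewrite mulr_ge0 //; lra.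
  by rewrite mulrDr mulr1 lerD2l.
apply: le_trans uB; apply: le_trans (ler_wpM2l (ltW uA0) h).
rewrite mulrDr mulr1 lerD2l [u A * _]mulrCA ler_wpM2l ?(ltW r0) //.
have -> : u A * (x / (1 + x)) = delta * u A / (u A + delta).
  by rewrite /x; field; rewrite !gt_eqF //; lra.
rewrite ler_pdivrMr; last by lra.
rewrite mulrAC ler_pdivlMr; last by lra.
have := ler_wpM2l (mulr_ge0 (ltW d0) (ltW d0)) gu; lra.
Qed.

(** * Counting iterations *)

Section Growth.
Variables (R : realType) (d : nat) (p : R) (s : nat) (sigma mu Rad : R).
Variables (f : 'rV[R]_d -> R) (O : 'rV[R]_d -> 'rV[R]_d * R) (x0 : 'rV[R]_d).
Variables (T : nat) (tr : trace R d) (xstar : 'rV[R]_d).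
Hypotheses (p2 : 2 <= p) (ps : p < s%:R) (sigma01 : 0 <= sigma < 1).
Hypothesis gms : gms_oracle p sigma f O.
Hypothesis mvb : movement_bound p s mu O.
Hypothesis tr_run : gppa_run p s sigma mu Rad f O x0 T tr.
Hypothesis cvx : convex_function [set: 'rV[R]_d] f.
Hypothesis dif : forall x, differentiable f x.
Hypothesis xmin : forall x, f xstar <= f x.
Hypotheses (mu0 : 0 < mu) (Rad0 : 0 < Rad).
Hypothesis (D_Rad : pnorm p (xstar - x0) <= Rad).

Let c := step_coef sigma.
Let K1 : R := 3 / (1 - sigma).
Let u t := scaled_weight p s mu Rad (sumA tr t).
Let gain := movement_gain p tr.

Lemma run_sumA_le i j : (i <= j <= T)%N -> sumA tr i <= sumA tr j.
Proof.
elim: j => [|j IH] /andP[ij jT]; first by move: ij; rewrite leqn0 => /eqP ->.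
move: ij; rewrite leq_eqVlt => /predU1P[->//|ij].
apply: le_trans (ltW (run_sumA_lt gms tr_run jT)).
by apply: IH; rewrite -ltnS ij ltnW.
Qed.

Lemma run_tref t : (t < T)%N -> (0 < tref tr t.+1 <= maxn 1 t)%N.
Proof.
elim: t => [|t IH] tT; have [_ _ _ tref0 /(_ _ tT) it] := tr_run.
  by rewrite (gppa_tref it) /= tref0.
rewrite (gppa_tref it); case: ifP => _; first by rewrite leq_maxr.
have /andP[-> h] := IH (ltnW tT); rewrite /=; apply: (leq_trans h).
by rewrite geq_max leq_maxl (leq_trans (leqnSn t)) // leq_maxr.
Qed.

Lemma run_tref_weight t : (0 < t < T)%N ->
  [/\ 0 < sumA tr (tref tr t.+1), sumA tr (tref tr t.+1) <= sumA tr t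
    & sumA tr t <= 2 * sumA tr (tref tr t.+1)].
Proof.
move=> /andP[t0 tT]; have /andP[r0 rt] := run_tref tT.
have {}rt : (tref tr t.+1 <= t)%N by rewrite (maxn_idPr t0) in rt.
have h1 : 0 < sumA tr (tref tr t.+1).
  by apply: (run_sumA_gt0 gms tr_run); rewrite r0 (leq_trans rt) // ltnW.
split => //; first by apply: run_sumA_le; rewrite rt ltnW.
have At0 := run_sumA_ge0 gms tr_run (ltnW tT).
have [_ _ _ _ /(_ _ tT) it] := tr_run.
rewrite (gppa_tref it) t0 /=.
by case: (leP (2 * sumA tr (tref tr t)) (sumA tr t)) => [_|/ltW //]; lra.
Qed.

(** The term of [run_value_bound] that contains the values of [f] is
nonnegative at a minimizer. *)
Lemma run_gain_bound t : (t <= T)%N -> gain t <= K1 * pnorm p (xstar - x0) `^ p.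
Proof.
move=> tT; have := run_value_bound p2 sigma01 gms tr_run cvx dif xstar tT.
have s1 : 0 < 1 - sigma by have /andP[? ?] := sigma01; lra.
have := mulr_ge0 (run_sumA_ge0 gms tr_run tT).
move=> /(_ (f (iterx tr t) - f xstar)); rewrite subr_ge0 xmin => /(_ isT) h0 h1.
rewrite /K1 -ler_pdivrMl; last by rewrite divr_gt0.
have -> : (3 / (1 - sigma))^-1 = (1 - sigma) / 3 by rewrite invf_div.
by rewrite -/gain in h1; lra.
Qed.

Lemma movement_gain_le i j : (i <= j <= T)%N -> gain i <= gain j.
Proof.
elim: j => [|j IH] /andP[ij jT]; first by move: ij; rewrite leqn0 => /eqP ->.
move: ij; rewrite leq_eqVlt => /predU1P[->//|ij].
have [_ _ _ _ /(_ _ jT) it] := tr_run.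
rewrite /gain (movement_gain_step p tr j); apply: ler_wpDr.
  rewrite !mulr_ge0 ?powR_ge0 //.
  - by rewrite addr_ge0 ?(run_sumA_ge0 gms tr_run (ltnW jT)) // ltW
      // (gppa_stepa_gt0 it).
  - exact: (run_beta_ge0 gms tr_run).
  - by have [] := run_gms gms tr_run jT.
by apply: IH; rewrite -ltnS ij ltnW.
Qed.

Lemma run_movement t : (t < T)%N ->
  lam tr t.+1 <= mu ^+ s * pnorm p (iterx' tr t.+1 - itery tr t) `^ (s%:R - p).
Proof.
move=> tT; have [_ _ _ _ /(_ _ tT) it] := tr_run.
have [l0 _ _] := run_gms gms tr_run tT.
have := mvb (itery tr t); rewrite -(gppa_oracle it) pnormE.
have m0 : 0 < mu ^+ s by exact: exprn_gt0.
have sp0 : 0 < s%:R - p by rewrite subr_gt0.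
move=> h; rewrite -ler_pdivrMl // mulrC.
have q0 : 0 <= lam tr t.+1 / mu ^+ s by rewrite divr_ge0 // ltW.
have -> : lam tr t.+1 / mu ^+ s
    = ((lam tr t.+1 / mu ^+ s) `^ (s%:R - p)^-1) `^ (s%:R - p).
  by rewrite -powRrM mulVf ?gt_eqF // powRr1.
by apply: ge0_ler_powR; rewrite ?nnegrE ?powR_ge0 ?pnorm_ge0 // ltW.
Qed.

Definition growth_per_step (g : R) : R :=
  rate_exponent p s * ((2 * c)^-1 * g / (g + (2 * c)^-1)).

(** Number of iterations that are paid for by one unit of scaled weight, as
long as the scaled weight is at least [g]: the first summand counts iterations
with [beta = 1], the second one those with [beta < 1]. *)
Definition steps_per_weight (g : R) : R := (growth_per_step g)^-1 + K1.

Lemma half_coef_gt0 : 0 < (2 * c)^-1 :> R.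
Proof. by rewrite invr_gt0 mulr_gt0 // (step_coef_gt0 sigma01). Qed.

Lemma growth_per_step_gt0 g : 0 < g -> 0 < growth_per_step g.
Proof.
move=> g0; have h := half_coef_gt0.
by rewrite mulr_gt0 ?(rate_exponent_gt0 p2 ps) // divr_gt0 ?mulr_gt0 ?addr_gt0.
Qed.

Lemma run_scaled_weight_le i j : (i <= j <= T)%N -> u i <= u j.
Proof.
move=> ij; apply: (le_scaled_weight _ p2 ps mu0); last exact: run_sumA_le.
apply: (run_sumA_ge0 gms tr_run).
by have /andP[h1 h2] := ij; exact: leq_trans h2.
Qed.

(** The first summand is at least [1] if [beta = 1] and the second one is if
[beta < 1]. *)
Lemma run_counting_step t g : (0 < t < T)%N -> 0 < g -> g <= u t ->
  1 <= (u t.+1 - u t) / growth_per_step g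
       + u t.+1 * (gain t.+1 - gain t) / Rad `^ p.
Proof.
move=> tb g0 gu; have /andP[t0 tT] := tb.
have [Ar0 ArA AAr] := run_tref_weight tb.
have [_ _ _ _ /(_ _ tT) it] := tr_run.
have c0 := step_coef_gt0 sigma01.
have a0 := gppa_stepa_gt0 it.
have eqa := gppa_stepa it.
have lbE : lambar tr t.+1 = lambar_rule p s mu Rad (sumA tr (tref tr t.+1)).
  by rewrite (gppa_lambar it) gtn_eqF.
have gp0 := growth_per_step_gt0 g0.
have RP0 : 0 < Rad `^ p by exact: powR_gt0.
have ut : u t <= u t.+1 by apply: run_scaled_weight_le; rewrite leqnSn.
have gt : gain t <= gain t.+1 by apply: movement_gain_le; rewrite leqnSn.
have u1 : 0 < u t.+1.
  apply: (scaled_weight_gt0 p s mu0 Rad0); apply: (run_sumA_gt0 gms tr_run).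
  by rewrite ltn0Sn.
have [b1|bn1] := eqVneq (beta tr t.+1) 1.
  rewrite lbE in eqa.
  have := scaled_weight_increment p2 ps mu0 Rad0 c0 Ar0 ArA AAr a0 g0 gu eqa.
  have -> : sumA tr t + stepa tr t.+1 = sumA tr t.+1.
    by rewrite (gppa_A it) b1 mul1r.
  rewrite -/(u t) -/(u t.+1) -/c -/(growth_per_step g) => h.
  have : 1 <= (u t.+1 - u t) / growth_per_step g.
    by rewrite ler_pdivlMr // mul1r; lra.
  have : 0 <= u t.+1 * (gain t.+1 - gain t) / Rad `^ p.
    by rewrite !mulr_ge0 ?invr_ge0 ?subr_ge0 // ltW.
  lra.
have [bl lbl] := run_beta_lt1 gms tr_run tT bn1.
have : 0 <= (u t.+1 - u t) / growth_per_step g.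
  by rewrite divr_ge0 ?subr_ge0 // ltW.
suff : 1 <= u t.+1 * (gain t.+1 - gain t) / Rad `^ p by lra.
rewrite ler_pdivlMr // mul1r.
have e := lambar_rule_movement p2 ps mu0 Rad0 Ar0.
rewrite -lbE in e.
have sp0 : 0 < s%:R - p by rewrite subr_gt0.
have m0 : 0 < mu ^+ s by exact: exprn_gt0.
have lb0 : 0 <= lambar tr t.+1 := run_lambar_ge0 tr_run tT.
set r := pnorm p (iterx' tr t.+1 - itery tr t).
have r0 : 0 <= r := pnorm_ge0 _ _.
have hr : (lambar tr t.+1 / mu ^+ s) `^ (p / (s%:R - p)) <= r `^ p.
  have q0 : 0 <= lambar tr t.+1 / mu ^+ s by rewrite divr_ge0 // ltW.
  rewrite [p / _]mulrC powRrM; apply: ge0_ler_powR; rewrite ?nnegrE ?powR_ge0 //.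
    by apply: le_trans p2.
  apply: (powR_le_inv sp0); rewrite ?powR_ge0 // -powRrM mulVf ?gt_eqF //.
  rewrite powRr1 // ler_pdivrMr // mulrC.
  exact: le_trans (ltW lbl) (run_movement tT).
rewrite /gain (movement_gain_step p tr t) [_ + _ - _]addrAC subrr add0r -/r.
have ur0 : 0 < u (tref tr t.+1) by exact: scaled_weight_gt0.
have uru : u (tref tr t.+1) <= u t.+1.
  apply: le_trans ut; exact: (le_scaled_weight Rad p2 ps mu0 (ltW Ar0) ArA).
have -> : (sumA tr t + stepa tr t.+1) * beta tr t.+1 * lam tr t.+1 * r `^ p
  = (sumA tr t + stepa tr t.+1) * lambar tr t.+1 * r `^ p by rewrite -bl; ring.
have step : Rad `^ p / u (tref tr t.+1)
   <= (sumA tr t + stepa tr t.+1) * lambar tr t.+1 * r `^ p.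
  rewrite /u -e; apply: ler_pM; rewrite ?powR_ge0 ?mulr_ge0 ?(ltW Ar0) //.
  by apply: ler_wpM2r => //; lra.
move: step; rewrite ler_pdivrMr // => step; apply: (le_trans step).
rewrite mulrC ler_wpM2r // !mulr_ge0 ?powR_ge0 //.
by rewrite addr_ge0 ?(run_sumA_ge0 gms tr_run (ltnW tT)) // ltW.
Qed.

(** The scaled weights are nondecreasing, so the movement of all iterations
can be charged at the last scaled weight. *)
Lemma run_counting t0 t g : (0 < t0)%N -> (t0 <= t <= T)%N ->
  0 < g -> g <= u t0 ->
  (t - t0)%:R <= (u t - u t0) / growth_per_step g
                 + u t * (gain t - gain t0) / Rad `^ p.
Proof.
move=> t00; elim: t => [|t IH] /andP[t0t tT] g0 gu.
  by move: t0t t00; rewrite leqn0 => /eqP ->.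
move: t0t; rewrite leq_eqVlt => /predU1P[<-|t0t].
  by rewrite subnn !subrr mulr0 !mul0r addr0.
rewrite ltnS in t0t; rewrite subSn // -natr1.
have tb : (0 < t < T)%N by rewrite (leq_trans t00 t0t).
have gut : g <= u t by apply: (le_trans gu); apply: run_scaled_weight_le; rewrite t0t ltnW.
have h1 : (t0 <= t <= T)%N by rewrite t0t ltnW.
have := IH h1 g0 gu.
have := run_counting_step tb g0 gut.
have : u t * (gain t - gain t0) / Rad `^ p <= u t.+1 * (gain t - gain t0) / Rad `^ p.
  rewrite ler_wpM2r ?invr_ge0 ?powR_ge0 // ler_wpM2r ?subr_ge0 ?movement_gain_le //.
  by apply: run_scaled_weight_le; rewrite leqnSn.
lra.
Qed.

Lemma run_length t0 t g : (0 < t0)%N -> (t0 <= t <= T)%N ->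
  0 < g -> g <= u t0 -> (t - t0)%:R <= steps_per_weight g * u t.
Proof.
move=> t00 t0t g0 gu; apply: le_trans (run_counting t00 t0t g0 gu) _.
have /andP[h1 tT] := t0t.
have gp := growth_per_step_gt0 g0.
have RP0 : 0 < Rad `^ p by exact: powR_gt0.
have ut : 0 < u t.
  apply: (scaled_weight_gt0 p s mu0 Rad0); apply: (run_sumA_gt0 gms tr_run).
  by rewrite (leq_trans t00).
have u0 : 0 < u t0 by exact: lt_le_trans gu.
have g00 : 0 <= gain t0.
  have := @movement_gain_le 0%N t0; rewrite (leq_trans h1 tT) => /(_ isT).
  by rewrite {1}/gain /movement_gain big_geq.
have s1 : 0 < 1 - sigma by have /andP[? ?] := sigma01; lra.
have K10 : 0 <= K1 by rewrite divr_ge0 // ltW.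
have gR : gain t - gain t0 <= K1 * Rad `^ p.
  have : pnorm p (xstar - x0) `^ p <= Rad `^ p.
    apply: ge0_ler_powR; rewrite ?nnegrE ?pnorm_ge0 ?(ltW Rad0) //.
    exact: le_trans p2.
  move=> /(ler_wpM2l K10); have := run_gain_bound tT; lra.
rewrite /steps_per_weight [leRHS]mulrDl; apply: lerD.
  by rewrite mulrC ler_wpM2l ?invr_ge0 ?(ltW gp) //; lra.
rewrite ler_pdivrMr // -mulrA [K1 * _]mulrC.
by rewrite -mulrA ler_wpM2l ?(ltW ut) // mulrC.
Qed.

(** If [beta = 1], the first weight is [c^(-p)].  Otherwise it is
[c^(-p) / lam], and [lam] is at most [mu^s r^(s-p)] where the potential bounds
the first movement [r] by a multiple of the radius. *)
Lemma first_weight (Dlow : R) : (0 < T)%N -> 0 <= Dlow -> Dlow <= Rad ->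
  Num.min (mu ^+ s * Dlow `^ (s%:R - p)) ((c * K1) `^ (s%:R - p))^-1 / c `^ p
    <= mu ^+ s * Rad `^ (s%:R - p) * sumA tr 1.
Proof.
move=> T0 Dl0 DR; have [A0 _ _ _ /(_ _ T0) it] := tr_run.
have c0 : 0 < c := step_coef_gt0 sigma01.
have p0 : 0 < p by apply: lt_le_trans p2.
have sp0 : 0 < s%:R - p by rewrite subr_gt0.
have m0 : 0 < mu ^+ s by exact: exprn_gt0.
have a0 := gppa_stepa_gt0 it.
have cp0 : 0 < c `^ p by exact: powR_gt0.
have lb1 : lambar tr 1 = 1 by rewrite (gppa_lambar it).
have aE : stepa tr 1 = (c `^ p)^-1.
  have := gppa_stepa it; rewrite lb1 mul1r A0 add0r -/c.
  rewrite powRM ?(ltW a0) ?(ltW c0) // -(mulr_powRB1 (ltW a0) p0) mulrA.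
  have P := powR_gt0 (p - 1) a0.
  rewrite -[RHS]mul1r => /(mulIf (lt0r_neq0 P)) h.
  by apply: (mulfI (lt0r_neq0 cp0)); rewrite h divff // gt_eqF.
have AE : sumA tr 1 = beta tr 1 / c `^ p by rewrite (gppa_A it) A0 add0r aE.
rewrite AE mulrA ler_wpM2r ?invr_ge0 ?(ltW cp0) // ge_min; apply/orP.
have [->|bn1] := eqVneq (beta tr 1) 1.
  left; rewrite mulr1 ler_wpM2l ?(ltW m0) //.
  by apply: ge0_ler_powR; rewrite ?nnegrE // ltW.
right; have [bl lbl] := run_beta_lt1 gms tr_run T0 bn1.
rewrite lb1 in bl lbl.
have l0 : 0 < lam tr 1 by apply: lt_trans lbl.
have bE : beta tr 1 = (lam tr 1)^-1.
  by apply: (mulIf (lt0r_neq0 l0)); rewrite bl mulVf // gt_eqF.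
set r := pnorm p (iterx' tr 1 - itery tr 0).
have r0 : 0 <= r := pnorm_ge0 _ _.
have s1 : 0 < 1 - sigma by have /andP[? ?] := sigma01; lra.
have K11 : 1 <= K1.
  by rewrite ler_pdivlMr // mul1r; have /andP[? ?] := sigma01; lra.
have K10 : 0 < K1 by apply: lt_le_trans K11.
have rR : r <= c * K1 * Rad.
  apply: (powR_le_inv p0 r0); first exact: mulr_ge0 (mulr_ge0 (ltW c0) (ltW K10)) (ltW Rad0).
  have := run_gain_bound T0; rewrite /gain /movement_gain big_nat1 /= A0 add0r.
  rewrite -/r.
  have -> : stepa tr 1 * beta tr 1 * lam tr 1 * r `^ p
    = r `^ p / c `^ p * (beta tr 1 * lam tr 1) by rewrite aE; ring.
  rewrite bl mulr1 ler_pdivrMr // => h; apply: (le_trans h).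
  have K1R := mulr_ge0 (ltW K10) (ltW Rad0).
  rewrite -[c * K1 * Rad]mulrA (powRM _ (ltW c0) K1R).
  rewrite mulrC (ler_wpM2l (ltW cp0)) // (powRM _ (ltW K10) (ltW Rad0)).
  apply: ler_pM; rewrite ?powR_ge0 ?(ltW K10) //.
    by apply: le1r_powR => //; have := p2; lra.
  by apply: ge0_ler_powR; rewrite ?nnegrE ?pnorm_ge0 ?(ltW p0) ?(ltW Rad0).
have cK0 : 0 < c * K1 by exact: mulr_gt0.
have P0 : 0 < (c * K1) `^ (s%:R - p) by exact: powR_gt0.
rewrite bE ler_pdivlMr // mulrC ler_pdivrMr //.
apply: (le_trans (run_movement T0)); rewrite -/r -mulrA ler_wpM2l ?(ltW m0) //.
rewrite -powRM ?(ltW cK0) ?(ltW Rad0) //.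
apply: ge0_ler_powR; rewrite ?nnegrE ?(ltW sp0) // 1?mulrC //.
by rewrite mulr_ge0 ?(ltW Rad0) ?(ltW cK0).
Qed.

Lemma run_length_from_start t g : (0 < t <= T)%N -> 0 < g -> g <= u 1%N ->
  t%:R <= (steps_per_weight g + g^-1) * u t.
Proof.
move=> /andP[t0 tT] g0 gu.
have t1 : (1 <= t <= T)%N by rewrite t0.
have := run_length (ltn0Sn 0) t1 g0 gu.
have : 1 <= g^-1 * u t.
  rewrite mulrC ler_pdivlMr // mul1r; apply: (le_trans gu).
  by apply: run_scaled_weight_le.
have -> : t%:R = (t - 1)%:R + 1 :> R by rewrite natr1 subn1 prednK.
lra.
Qed.

(** By the choice of [t0] the scaled weight has reached [1] after [t0]
iterations, and at least half of the iterations come later. *)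
Lemma run_length_after_burn_in t0 g : (0 < t0)%N -> (2 * t0 <= T)%N ->
  0 < g -> g <= u 1%N -> steps_per_weight g + g^-1 <= t0%:R ->
  T%:R <= 2 * steps_per_weight 1 * u T.
Proof.
move=> t00 t0T g0 gu Kt0.
have t0T' : (t0 <= T)%N by apply: leq_trans t0T; rewrite leq_pmull.
have t0R : 0 < t0%:R :> R by rewrite ltr0n.
have u0 : 0 <= u t0 := powR_ge0 _ _.
have u1 : 1 <= u t0.
  have : t0%:R * 1 <= t0%:R * u t0.
    rewrite mulr1; apply: (le_trans (@run_length_from_start t0 g _ g0 gu)).
      by rewrite t00.
    by rewrite ler_wpM2r.
  by rewrite ler_pM2l.
have t0t : (t0 <= T <= T)%N by rewrite t0T' leqnn.
have := run_length t00 t0t ltr01 u1.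
rewrite natrB //.
have : 2 * t0%:R <= T%:R :> R by rewrite -natrM ler_nat.
lra.
Qed.

End Growth.

(** * The convergence rate *)

Lemma iteration_boundE (R : realType) (p : R) (s : nat) (D L eps : R) :
  2 <= p -> p < s%:R ->
  iteration_bound p s D L eps
    = D `^ (s%:R * rate_exponent p s) * (L / eps) `^ rate_exponent p s.
Proof.
move=> p2 ps; have N0 := rate_denominator_gt0 p2 ps.
have p0 : p != 0 by rewrite gt_eqF //; lra.
have s0 : s%:R != 0 :> R by rewrite gt_eqF //; lra.
rewrite /iteration_bound /rate_exponent.
have e : 1 + (p^-1 - s%:R^-1) = (p * s%:R - p + s%:R) / (p * s%:R).
  by field; rewrite p0 s0.
by rewrite e; congr (_ `^ _ * _ `^ _); field; rewrite p0 s0 gt_eqF.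
Qed.

(** The lower bound of [first_weight], on the scale of [scaled_weight]. *)
Definition first_scaled_weight (R : realType) (p : R) (s : nat) (sigma m : R) : R :=
  (Num.min m ((step_coef sigma * (3 / (1 - sigma))) `^ (s%:R - p))^-1
    / step_coef sigma `^ p) `^ rate_exponent p s.

Lemma first_scaled_weight_gt0 (R : realType) (p : R) (s : nat) (sigma m : R) :
  0 <= sigma < 1 -> 0 < m -> 0 < first_scaled_weight p s sigma m.
Proof.
move=> sg m0; have c0 := step_coef_gt0 sg.
have s1 : 0 < 1 - sigma by have /andP[? ?] := sg; lra.
rewrite powR_gt0 // divr_gt0 ?powR_gt0 // lt_min m0 invr_gt0 powR_gt0 //.
by rewrite mulr_gt0 // divr_gt0.
Qed.

Lemma steps_per_weight_gt0 (R : realType) (p : R) (s : nat) (sigma g : R) :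
  2 <= p -> p < s%:R -> 0 <= sigma < 1 -> 0 < g ->
  0 < steps_per_weight p s sigma g.
Proof.
move=> p2 ps sg g0; have s1 : 0 < 1 - sigma by have /andP[? ?] := sg; lra.
by rewrite addr_gt0 ?invr_gt0 ?(growth_per_step_gt0 p2 ps sg g0) // divr_gt0.
Qed.

Definition rate_steps (R : realType) (p : R) (s : nat) (sigma : R) : R :=
  let g := first_scaled_weight p s sigma (s%:R / (s.-1)`!%:R) in
  Num.max (steps_per_weight p s sigma g + g^-1) (2 * steps_per_weight p s sigma 1).

Definition rate_constant (R : realType) (p : R) (s : nat) (sigma kappa : R) : R :=
  rate_steps p s sigma
  * (kappa `^ (s%:R - p) * (s%:R / (s.-1)`!%:R)) `^ rate_exponent p s.

Definition burn_in (R : realType) (p : R) (s : nat) (sigma m : R) : nat :=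
  let g := first_scaled_weight p s sigma m in
  Num.bound (steps_per_weight p s sigma g + g^-1).

(** For positive [D], the accuracy at which the iteration bound equals twice
the length of the burn-in. *)
Definition small_accuracy (R : realType) (p : R) (s : nat)
    (sigma kappa L mu D : R) : R :=
  if 0 < D then
    L / (2 * (burn_in p s sigma (mu ^+ s * D `^ (s%:R - p)))%:R
         / (rate_constant p s sigma kappa * D `^ (s%:R * rate_exponent p s)))
        `^ (rate_exponent p s)^-1
  else 1.

Section Constants.
Variables (R : realType) (p : R) (s : nat) (sigma kappa : R).
Hypotheses (p2 : 2 <= p) (ps : p < s%:R) (sigma01 : 0 <= sigma < 1).
Hypothesis (kappa1 : 1 <= kappa).

Lemma smoothness_factor_gt0 : 0 < s%:R / (s.-1)`!%:R :> R.
Proof.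
rewrite divr_gt0 ?ltr0n ?fact_gt0 // -(ltr0n R).
by apply: lt_trans ps; apply: lt_le_trans p2.
Qed.

Lemma rate_steps_gt0 : 0 < rate_steps p s sigma.
Proof.
rewrite /rate_steps lt_max; apply/orP; right.
by rewrite mulr_gt0 // steps_per_weight_gt0.
Qed.

Lemma rate_constant_gt0 : 0 < rate_constant p s sigma kappa.
Proof.
rewrite mulr_gt0 ?rate_steps_gt0 // powR_gt0 // mulr_gt0 ?smoothness_factor_gt0 //.
by rewrite powR_gt0 // (lt_le_trans ltr01).
Qed.

Lemma burn_in_spec m : 0 < m ->
  let g := first_scaled_weight p s sigma m in
  (0 < burn_in p s sigma m)%N
  /\ steps_per_weight p s sigma g + g^-1 <= (burn_in p s sigma m)%:R.
Proof.
move=> m0 g; have g0 : 0 < g by exact: first_scaled_weight_gt0.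
have X0 : 0 < steps_per_weight p s sigma g + g^-1.
  by rewrite addr_gt0 ?steps_per_weight_gt0 // invr_gt0.
have := archi_boundP (ltW X0); rewrite -/(burn_in p s sigma m) => h.
split; last exact: ltW.
by rewrite -(ltr0n R); apply: lt_trans h.
Qed.

Lemma small_accuracy_gt0 L mu D : 0 < L -> 0 < mu ->
  0 < small_accuracy p s sigma kappa L mu D.
Proof.
move=> L0 mu0; rewrite /small_accuracy; case: ifP => // D0.
have m0 : 0 < mu ^+ s * D `^ (s%:R - p) by rewrite mulr_gt0 ?exprn_gt0 ?powR_gt0.
have [b0 _] := burn_in_spec m0.
rewrite divr_gt0 // powR_gt0 // divr_gt0 //.
  by rewrite mulr_gt0 // ltr0n.
by rewrite mulr_gt0 ?rate_constant_gt0 ?powR_gt0.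
Qed.

Lemma small_accuracy_steps L mu D eps : 0 < L -> 0 < mu -> 0 < D -> 0 < eps ->
  eps <= small_accuracy p s sigma kappa L mu D ->
  2 * (burn_in p s sigma (mu ^+ s * D `^ (s%:R - p)))%:R
    <= rate_constant p s sigma kappa * iteration_bound p s D L eps.
Proof.
move=> L0 mu0 D0 e0; rewrite /small_accuracy D0 iteration_boundE //.
have C0 := rate_constant_gt0; have r0 := rate_exponent_gt0 p2 ps.
have m0 : 0 < mu ^+ s * D `^ (s%:R - p) by rewrite mulr_gt0 ?exprn_gt0 ?powR_gt0.
have [b0 _] := burn_in_spec m0.
have B0 : 0 < 2 * (burn_in p s sigma (mu ^+ s * D `^ (s%:R - p)))%:R :> R.
  by rewrite mulr_gt0 // ltr0n.
have DD0 : 0 < D `^ (s%:R * rate_exponent p s) by exact: powR_gt0.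
move: B0; set B := 2 * _ => B0.
move: (rate_constant _ _ _ _) (rate_exponent _ _) C0 r0 DD0 => C r C0 r0.
move: (D `^ _) => DD DD0.
have CD0 : 0 < C * DD by exact: mulr_gt0.
have q0 : 0 < B / (C * DD) by exact: divr_gt0.
have P0 := powR_gt0 r^-1 q0.
rewrite ler_pdivlMr // mulrC -ler_pdivlMr // => h.
have := ge0_ler_powR (ltW r0) _ _ h.
rewrite !nnegrE (ltW P0) (divr_ge0 (ltW L0) (ltW e0)) => /(_ isT isT).
rewrite -powRrM mulVf ?gt_eqF // powRr1 ?(ltW q0) //.
by rewrite ler_pdivrMr // mulrC mulrA.
Qed.

End Constants.

(** In both regimes [T] is at most [rate_steps] times the last scaled weight.
Compared with the lower bound on [T], this yields [A_T >= D^p / eps]. *)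
Lemma gppa_rate (R : realType) (d : nat) (p : R) (s : nat)
    (sigma kappa L mu D Rad eps : R) (f : 'rV[R]_d -> R)
    (O : 'rV[R]_d -> 'rV[R]_d * R) (x0 xstar : 'rV[R]_d) (T : nat)
    (tr : trace R d) :
  2 <= p -> p < s%:R -> 0 <= sigma < 1 -> 1 <= kappa -> 0 < L -> 0 < mu ->
  mu ^+ s = s%:R * L / (s.-1)`!%:R ->
  convex_function [set: 'rV[R]_d] f -> (forall x, differentiable f x) ->
  (forall x, f xstar <= f x) ->
  gms_oracle p sigma f O -> movement_bound p s mu O ->
  pnorm p (xstar - x0) = D -> D <= Rad <= kappa * D ->
  0 < eps ->
  eps <= small_accuracy p s sigma kappa L mu D \/ 1 <= L * D `^ (s%:R - p) ->
  gppa_run p s sigma mu Rad f O x0 T tr -> (0 < T)%N ->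
  rate_constant p s sigma kappa * iteration_bound p s D L eps <= T%:R ->
  f (iterx tr T) - f xstar <= eps.
Proof.
move=> p2 ps sg k1 L0 mu0 muE cf df xmin gms mvb hD /andP[DR RkD] e0 hreg hrun T0 hT.
have p0 : 0 < p by lra.
have sp0 : 0 < s%:R - p by rewrite subr_gt0.
have AT0 : 0 < sumA tr T by apply: (run_sumA_gt0 gms hrun); rewrite T0 leqnn.
have s1 : 0 < 1 - sigma by have /andP[? ?] := sg; lra.
have gain0 : 0 <= movement_gain p tr T.
  have := @movement_gain_le _ _ _ _ _ _ _ _ _ _ _ _ gms hrun 0%N T.
  by rewrite leqnn => /(_ isT); rewrite {1}/movement_gain big_geq.
have val : sumA tr T * (f (iterx tr T) - f xstar) <= D `^ p.
  have := run_value_bound p2 sg gms hrun cf df xstar (leqnn T); rewrite hD.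
  have : 0 <= (1 - sigma) / 3 * movement_gain p tr T.
    by rewrite mulr_ge0 // divr_ge0 // ltW.
  lra.
have D_ge0 : 0 <= D by rewrite -hD pnorm_ge0.
have [D0|Dn] := eqVneq D 0.
  move: val; rewrite D0 powR0 ?gt_eqF // pmulr_rle0 // => h; lra.
have {D_ge0}D0 : 0 < D by rewrite lt_neqAle eq_sym Dn.
have Rad0 : 0 < Rad by exact: lt_le_trans DR.
have DRad : pnorm p (xstar - x0) <= Rad by rewrite hD.
have r0 := rate_exponent_gt0 p2 ps.
have C0 := rate_constant_gt0 p2 ps sg k1.
have F0 := smoothness_factor_gt0 p2 ps.
have start m : 0 < m -> m <= mu ^+ s * D `^ (s%:R - p) ->
    first_scaled_weight p s sigma m <= scaled_weight p s mu Rad (sumA tr 1).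
  move=> m0 mD; have c0 := step_coef_gt0 sg.
  have := first_weight p2 ps sg gms mvb hrun cf df xmin mu0 Rad0 DRad T0 (ltW D0) DR.
  have K0 : 0 < (step_coef sigma * (3 / (1 - sigma))) `^ (s%:R - p).
    by rewrite powR_gt0 // mulr_gt0 // divr_gt0.
  have cp0 : 0 < step_coef sigma `^ p by exact: powR_gt0.
  move=> h; apply: ge0_ler_powR; rewrite ?nnegrE.
  - exact: ltW.
  - by rewrite divr_ge0 ?powR_ge0 // le_min (ltW m0) invr_ge0 ltW.
  - by rewrite !mulr_ge0 ?powR_ge0 ?exprn_ge0 ?(ltW mu0) //
      (run_sumA_ge0 gms hrun).
  apply: le_trans h; rewrite ler_wpM2r ?invr_ge0 ?(ltW cp0) // le_min.
  by rewrite !ge_min mD lexx orbT.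
have steps : T%:R <= rate_steps p s sigma * scaled_weight p s mu Rad (sumA tr T).
  have uT0 : 0 <= scaled_weight p s mu Rad (sumA tr T) := powR_ge0 _ _.
  case: hreg => [small|big].
    have m0 : 0 < mu ^+ s * D `^ (s%:R - p).
      by rewrite mulr_gt0 ?exprn_gt0 ?powR_gt0.
    have [b0 hb] := burn_in_spec p2 ps sg m0.
    have bT : (2 * burn_in p s sigma (mu ^+ s * D `^ (s%:R - p)) <= T)%N.
      rewrite -(ler_nat R) natrM; apply: le_trans hT.
      exact: (small_accuracy_steps p2 ps sg k1 L0 mu0 D0 e0 small).
    have g0 := first_scaled_weight_gt0 p s sg m0.
    have := run_length_after_burn_in p2 ps sg gms mvb hrun cf df xmin mu0 Rad0 DRad
      b0 bT g0 (start _ m0 (lexx _)) hb.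
    move=> h; apply: (le_trans h); rewrite ler_wpM2r //.
    by rewrite /rate_steps le_max lexx orbT.
  have g0 := first_scaled_weight_gt0 p s sg F0.
  have mD : s%:R / (s.-1)`!%:R <= mu ^+ s * D `^ (s%:R - p).
    rewrite muE; have -> : s%:R * L / (s.-1)`!%:R * D `^ (s%:R - p)
      = s%:R / (s.-1)`!%:R * (L * D `^ (s%:R - p)) by ring.
    by rewrite ler_peMr // ltW.
  have T1 : (0 < T <= T)%N by rewrite T0 leqnn.
  have := run_length_from_start p2 ps sg gms mvb hrun cf df xmin mu0 Rad0 DRad
    T1 g0 (start _ F0 mD).
  move=> h; apply: (le_trans h); rewrite ler_wpM2r //.
  by rewrite /rate_steps le_max lexx.
have K0 := rate_steps_gt0 p2 ps sg.
have kp0 : 0 < kappa by lra.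
have H0 : 0 < kappa `^ (s%:R - p) * (s%:R / (s.-1)`!%:R).
  by rewrite mulr_gt0 // powR_gt0.
have DA : D `^ p / eps <= sumA tr T.
  have h : kappa `^ (s%:R - p) * (s%:R / (s.-1)`!%:R) * (D `^ s%:R * (L / eps))
      <= mu ^+ s * Rad `^ (s%:R - p) * sumA tr T.
    apply: (powR_le_inv r0).
    - by rewrite !mulr_ge0 ?(ltW F0) ?powR_ge0 ?invr_ge0 // ltW.
    - by rewrite !mulr_ge0 ?powR_ge0 ?exprn_ge0 // ltW.
    rewrite -(ler_pM2l K0); apply: le_trans steps.
    apply: le_trans hT; rewrite iteration_boundE // /rate_constant.
    have Le0 := divr_ge0 (ltW L0) (ltW e0).
    rewrite (powRM _ (ltW H0) (mulr_ge0 (powR_ge0 _ _) Le0)).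
    by rewrite (powRM _ (powR_ge0 D s%:R) Le0) -powRrM !mulrA.
  have Rk : Rad `^ (s%:R - p) <= kappa `^ (s%:R - p) * D `^ (s%:R - p).
    rewrite -powRM ?(ltW kp0) ?(ltW D0) //; apply: ge0_ler_powR; rewrite ?nnegrE //.
    - exact: ltW.
    - exact: ltW.
    - by rewrite mulr_ge0 // ltW.
  have G0 : 0 < kappa `^ (s%:R - p) * (s%:R / (s.-1)`!%:R) * (L * D `^ (s%:R - p)).
    by rewrite mulr_gt0 // mulr_gt0 // powR_gt0.
  rewrite -(ler_pM2l G0).
  have Ds : D `^ s%:R = D `^ (s%:R - p) * D `^ p.
    by rewrite -powRD ?subrK // Dn implybT.
  have e1 : kappa `^ (s%:R - p) * (s%:R / (s.-1)`!%:R) * (L * D `^ (s%:R - p))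
     * (D `^ p / eps)
    = kappa `^ (s%:R - p) * (s%:R / (s.-1)`!%:R) * (D `^ s%:R * (L / eps)).
    by rewrite Ds; ring.
  rewrite e1; apply: (le_trans h).
  have -> : kappa `^ (s%:R - p) * (s%:R / (s.-1)`!%:R) * (L * D `^ (s%:R - p))
     * sumA tr T
    = mu ^+ s * (kappa `^ (s%:R - p) * D `^ (s%:R - p)) * sumA tr T.
    by rewrite muE; ring.
  by rewrite ler_wpM2r ?(ltW AT0) // ler_wpM2l // exprn_ge0 // ltW.
rewrite -(ler_pM2l AT0); apply: (le_trans val).
by move: DA; rewrite ler_pdivrMr.
Qed.

(** * The step-size equation *)

(** Divided by [z^(p-1)], the equation for a root [z] equates a multiple of
[z] with [((A + z) / z)^(p-1)], which is nonincreasing. *)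
Lemma step_size_unique (R : realType) (p c l A a b : R) :
  1 < p -> 0 < c -> 0 <= A -> 0 < a -> 0 < b ->
  l * (c * a) `^ p = (A + a) `^ (p - 1) ->
  l * (c * b) `^ p = (A + b) `^ (p - 1) -> a = b.
Proof.
move=> p1 c0 A0; have p0 : 0 < p by lra.
have wlog_lt x y : 0 < x -> x < y ->
    l * (c * x) `^ p = (A + x) `^ (p - 1) ->
    l * (c * y) `^ p = (A + y) `^ (p - 1) -> False.
  move=> x0 xy ex ey; have y0 : 0 < y by lra.
  have norm z : 0 < z -> l * (c * z) `^ p = (A + z) `^ (p - 1) ->
      l * c `^ p * z = ((A + z) / z) `^ (p - 1).
    move=> z0 ez; have P := powR_gt0 (p - 1) z0.
    have z0' := ltW z0; have c0' := ltW c0.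
    rewrite powRM ?invr_ge0 //; last by lra.
    have -> : z^-1 `^ (p - 1) = (z `^ (p - 1))^-1.
      by rewrite -[z^-1](powR_inv1 z0') -powRrM mulN1r powRN.
    rewrite -ez (powRM _ c0' z0') -(mulr_powRB1 z0' p0).
    by field; rewrite gt_eqF.
  have hx := norm x x0 ex; have hy := norm y y0 ey.
  have l0 : 0 < l.
    have : 0 < l * (c * x) `^ p by rewrite ex powR_gt0 //; lra.
    by rewrite pmulr_lgt0 // powR_gt0 // mulr_gt0.
  have : l * c `^ p * x < l * c `^ p * y.
    by rewrite ltr_pM2l // mulr_gt0 // powR_gt0.
  rewrite hx hy ltNge => /negP; apply.
  apply: ge0_ler_powR; rewrite ?nnegrE.
  - by lra.
  - by rewrite divr_ge0 //; lra.
  - by rewrite divr_ge0 //; lra.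
  rewrite ler_pdivrMr // mulrAC ler_pdivlMr //.
  by have := ler_wpM2l A0 (ltW xy); lra.
move=> a0 b0 ea eb; case: (ltgtP a b) => // h; exfalso.
  exact: (wlog_lt a b).
exact: (wlog_lt b a).
Qed.

Lemma step_rootE (R : realType) (p c l A a : R) :
  1 < p -> 0 < c -> 0 <= A -> 0 < a ->
  l * (c * a) `^ p = (A + a) `^ (p - 1) -> step_root p c l A = a.
Proof.
move=> p1 c0 A0 a0 ea; apply: xget_unique => // b [b0 eb].
exact: (step_size_unique p1 c0 A0 b0 a0 eb ea).
Qed.

(** For [A = 0] the root is explicit.  For [A > 0] the intermediate value theorem
applies on [[0, M]], where [M] is so large that [A <= M] and the left side
is at least [(2 M)^(p-1)]. *)
Lemma step_root_spec (R : realType) (p c l A : R) :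
  2 <= p -> 0 < c -> 0 < l -> 0 <= A ->
  0 < step_root p c l A
  /\ l * (c * step_root p c l A) `^ p = (A + step_root p c l A) `^ (p - 1).
Proof.
move=> p2 c0 l0 A0; have p1 : 1 < p by lra. have p0 : 0 < p by lra.
suff [a [a0 ea]] : exists a : R, 0 < a /\ l * (c * a) `^ p = (A + a) `^ (p - 1).
  by rewrite (step_rootE p1 c0 A0 a0 ea).
have cp0 : 0 < l * c `^ p by rewrite mulr_gt0 // powR_gt0.
have [A00|An] := eqVneq A 0.
  have a0 : 0 < (l * c `^ p)^-1 by rewrite invr_gt0.
  exists (l * c `^ p)^-1; split=> //.
  rewrite A00 add0r (powRM _ (ltW c0) (ltW a0)) -(mulr_powRB1 (ltW a0) p0).
  by rewrite !mulrA divff ?mul1r // gt_eqF.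
have {A0}A0 : 0 < A by rewrite lt_neqAle eq_sym An.
pose M := Num.max A (2 `^ (p - 1) / (l * c `^ p)).
have MA : A <= M by rewrite le_max lexx.
have M0 : 0 < M by exact: lt_le_trans MA.
pose h (a : R) := l * `|c * a| `^ p - (A + a) `^ (p - 1).
have dh (x : R) : 0 <= x -> derivable h x 1.
  move=> x0; apply: derivableB.
    apply: derivableM; first exact: derivable_cst.
    have d1 := is_derive_abs_powR (c * x) p1.
    have d2 : derivable ( *%R c) x 1 by apply: derivableM.
    have [//] := @is_derive1_comp R _ ( *%R c) x _ _ d1 (derivableP d2).
  have Ax : 0 < A + x by lra.
  have d1 := is_derive1_powR (p - 1) Ax.
  have d2 : derivable (+%R A) x 1 by apply: derivableD.
  by have [] := @is_derive1_comp R _ (+%R A) x _ _ d1 (derivableP d2).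
have ch : {within `[0, M], continuous h}.
  apply: derivable_within_continuous => x; rewrite in_itv /= => /andP[x0 _].
  exact: dh.
have h0 : h 0 <= 0.
  rewrite /h mulr0 normr0 powR0 ?gt_eqF // mulr0 sub0r oppr_le0 powR_ge0 //.
have hM : 0 <= h M.
  rewrite /h subr_ge0 ger0_norm ?mulr_ge0 ?(ltW c0) ?(ltW M0) //.
  rewrite (powRM _ (ltW c0) (ltW M0)) -(mulr_powRB1 (ltW M0) p0).
  have h1 : (A + M) `^ (p - 1) <= 2 `^ (p - 1) * M `^ (p - 1).
    rewrite -powRM ?(ltW M0) //; apply: ge0_ler_powR; rewrite ?nnegrE; lra.
  apply: (le_trans h1); rewrite !mulrA ler_wpM2r ?powR_ge0 //.
  by rewrite mulrC -ler_pdivrMr // le_max lexx orbT.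
case: (@IVT R h 0 M 0 (ltW M0) ch) => [|a].
  by rewrite ge_min le_max h0 hM orbT.
rewrite in_itv /= => /andP[a_ge0 _] ha.
have a0 : 0 < a.
  rewrite lt_neqAle a_ge0 andbT; apply/eqP => a0.
  move: ha; rewrite -a0 /h mulr0 normr0 powR0 ?gt_eqF // mulr0 sub0r addr0.
  by move=> /eqP; rewrite oppr_eq0 gt_eqF // powR_gt0.
exists a; split=> //; apply/eqP; rewrite -subr_eq0.
by move/eqP: ha; rewrite /h ger0_norm // mulr_ge0 // ltW.
Qed.

(** * Existence of an infinite run *)

(** One iteration depends on the earlier ones only through these values;
[st_Aref] is the weight with index [st_tref]. *)
Record gppa_state (R : realType) (d : nat) := GppaState {
  st_x : 'rV[R]_d; st_z : 'rV[R]_d; st_x' : 'rV[R]_d; st_y : 'rV[R]_d;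
  st_gsum : 'rV[R]_d;
  st_a : R; st_A : R; st_Aref : R; st_lam : R; st_lambar : R; st_beta : R;
  st_tref : nat
}.

Section Existence.
Variables (R : realType) (d : nat) (p : R) (s : nat) (sigma mu Rad : R).
Variables (f : 'rV[R]_d -> R) (O : 'rV[R]_d -> 'rV[R]_d * R) (x0 : 'rV[R]_d).

Definition gppa_init : gppa_state R d :=
  GppaState x0 x0 x0 x0 0 0 0 0 0 0 0 1.

Definition gppa_next (t : nat) (S : gppa_state R d) : gppa_state R d :=
  let doubled := (0 < t)%N && (2 * st_Aref S <= st_A S) in
  let Aref := if doubled then st_A S else st_Aref S in
  let lb := if t == 0%N then 1 else lambar_rule p s mu Rad Aref in
  let a := step_root p (step_coef sigma) lb (st_A S) in
  let A' := st_A S + a in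
  let y := (st_A S / A') *: st_x S + (a / A') *: st_z S in
  let x' := (O y).1 in
  let l := (O y).2 in
  let b := if l == 0 then 1 else Num.min 1 (lb / l) in
  let An := st_A S + b * a in
  let gs := st_gsum S + (a * b) *: grad f x' in
  GppaState
    (An^-1 *: (((1 - b) * st_A S) *: st_x S + (b * A') *: x'))
    (prox_center p x0 gs) x' y gs a An (if t == 0%N then An else Aref) l lb b
    (if doubled then t else st_tref S).

Fixpoint gppa_states (t : nat) : gppa_state R d :=
  if t is t'.+1 then gppa_next t' (gppa_states t') else gppa_init.

Definition gppa_trace : trace R d := {|
  iterx := fun t => st_x (gppa_states t);
  iterx' := fun t => st_x' (gppa_states t);
  itery := fun t => st_y (gppa_states t.+1);
  iterz := fun t => st_z (gppa_states t);
  stepa := fun t => st_a (gppa_states t);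
  sumA := fun t => st_A (gppa_states t);
  lam := fun t => st_lam (gppa_states t);
  lambar := fun t => st_lambar (gppa_states t);
  beta := fun t => st_beta (gppa_states t);
  tref := fun t => st_tref (gppa_states t)
|}.

Hypotheses (p2 : 2 <= p) (sigma01 : 0 <= sigma < 1) (mu0 : 0 < mu).
Hypotheses (Rad0 : 0 < Rad) (gms : gms_oracle p sigma f O).

Lemma gms_gamma_ge0 y : 0 <= (O y).2.
Proof. by have := gms y; case: (O y) => x g []. Qed.

Lemma gppa_trace_gsum t : st_gsum (gppa_states t) = grad_sum f gppa_trace t.
Proof.
elim: t => [|t IH]; first by rewrite /grad_sum big_geq.
by rewrite /grad_sum (big_nat_recr t.+1) //= IH.
Qed.

(** All weights are positive after the first iteration, so that the rule for
[lambar] gives a positive number and the step-size equation has a root. *)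
Lemma gppa_states_weights t :
  0 <= st_A (gppa_states t) /\
  ((0 < t)%N -> 0 < st_A (gppa_states t) /\ 0 < st_Aref (gppa_states t)).
Proof.
elim: t => [|t [A0 IH]] //=.
move: (gppa_states t) A0 IH => S A0 IH.
set Aref := if (0 < t)%N && _ then st_A S else _.
set lb := if t == 0%N then 1 else _.
have Aref0 : (0 < t)%N -> 0 < Aref.
  by move=> t0; have [? ?] := IH t0; rewrite /Aref; case: ifP.
have lb0 : 0 < lb.
  rewrite /lb; case: (posnP t) => // t0.
  exact: lambar_rule_gt0 (Aref0 t0).
have [a0 _] := step_root_spec p2 (step_coef_gt0 sigma01) lb0 A0.
move: (step_root _ _ _ _) a0 => a a0.
move: (_ *: _ + _) => y; set b := if (O y).2 == 0 then 1 else _.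
have b0 : 0 < b.
  rewrite /b; have [//|ln] := eqVneq (O y).2 0.
  by rewrite lt_min ltr01 divr_gt0 // lt_neqAle eq_sym ln gms_gamma_ge0.
have An0 : 0 < st_A S + b * a by have := mulr_gt0 b0 a0; lra.
split; first exact: ltW.
by move=> _; split => //; case: (posnP t) => [_|/Aref0].
Qed.

(** After iteration [0] both sides are the weight [A_1], which exists only
then; this is why [gppa_next] treats [t = 0] apart. *)
Lemma gppa_trace_reference t : (0 < t)%N ->
  st_Aref (gppa_states t) = sumA gppa_trace (st_tref (gppa_states t)).
Proof.
elim: t => [|t IH] // _; case: (posnP t) => [->|t0] //.
rewrite /= t0 gtn_eqF //=; case: ifP => _ //.
exact: IH.
Qed.

Lemma gppa_trace_run T : gppa_run p s sigma mu Rad f O x0 T gppa_trace.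
Proof.
split; [reflexivity..|move=> t _].
have [A0 Apos] := gppa_states_weights t.
have Aref_eq := @gppa_trace_reference t.
set S := gppa_states t in A0 Apos Aref_eq *.
pose Aref := if (0 < t)%N && (2 * st_Aref S <= st_A S) then st_A S else st_Aref S.
pose lb := if t == 0%N then 1 else lambar_rule p s mu Rad Aref.
have lb0 : 0 < lb.
  rewrite /lb; case: (posnP t) => // t0; have [? ?] := Apos t0.
  by apply: lambar_rule_gt0 => //; rewrite /Aref; case: ifP.
have [a0 ea] := step_root_spec p2 (step_coef_gt0 sigma01) lb0 A0.
have dE : (0 < t)%N && (2 * st_Aref S <= st_A S)
    = (0 < t)%N && (2 * sumA gppa_trace (tref gppa_trace t) <= sumA gppa_trace t).
  by case: (posnP t) => //= t0; rewrite (Aref_eq t0).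
have trefE : tref gppa_trace t.+1
    = if (0 < t)%N && (2 * st_Aref S <= st_A S) then t else st_tref S by [].
constructor.
- by rewrite trefE dE.
- rewrite trefE; change (lambar gppa_trace t.+1) with lb; rewrite /lb.
  case: (posnP t) => //= t0; congr lambar_rule; rewrite /Aref t0 /=.
  by case: ifP => _ //; rewrite (Aref_eq t0).
- exact a0.
- exact ea.
- reflexivity.
- by rewrite [RHS]surjective_pairing.
- reflexivity.
- move=> phi z; rewrite {}/phi !pnormE.
  have := prox_center_growth x0 (grad_sum f gppa_trace t.+1) z p2.
  have <- : iterz gppa_trace t.+1 = prox_center p x0 (grad_sum f gppa_trace t.+1).
    by rewrite -gppa_trace_gsum.
  rewrite !inner_grad_sum; move: (iterz gppa_trace t.+1) => z1.
  by have := powR_ge0 (pnorm p (2^-1 *: (z - z1))) p; lra.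
- reflexivity.
- reflexivity.
Qed.

End Existence.

(** * A program for one iteration *)

Definition prog_lambar : program :=
  [:: SConst 8 0; SConst 9 1; SConst 10 2;
      (* reference weight after the doubling test *)
      SOp OpMul 13 10 7; SSel 11 13 6 6 7;
      (* N = p s - p + s *)
      SOp OpMul 14 0 1; SOp OpSub 14 14 0; SOp OpAdd 14 14 1;
      SOp OpSub 15 1 0; SOp OpAdd 16 0 9; SOp OpMul 16 15 16;
      SOp OpDiv 16 16 14; SOp OpSub 16 8 16; SOp OpPow 16 11 16;
      SOp OpMul 17 0 15; SOp OpDiv 17 17 14; SOp OpPow 18 4 0;
      SOp OpPow 18 18 17;
      SOp OpMul 19 0 0; SOp OpMul 19 1 19; SOp OpDiv 19 19 14;
      SOp OpPow 19 3 19;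
      SOp OpMul 16 16 18; SOp OpMul 16 16 19;
      SSel 12 5 8 9 16].

Definition prog_stepsize : program :=
  [:: SConst 15 3; SOp OpMul 16 15 2; SOp OpAdd 16 15 16; SOp OpSub 17 9 2;
      SOp OpDiv 13 16 17; SRoot 14 0 13 12 6; SOp OpAdd 15 6 14].

Definition prog_oracle : program :=
  [:: SOp OpDiv 16 6 15; SOp OpDiv 17 14 15;
      VFill 7 16; VOp OpMul 7 7 1; VFill 8 17; VOp OpMul 8 8 2;
      VOp OpAdd 4 7 8; Oracle 5 6 4].

Definition prog_beta : program :=
  [:: (* coordinatewise absolute value, then the p-norm *)
      VOp OpSub 7 5 4; VFill 8 8; VOp OpSub 9 8 7; VSel 9 8 7 7 9;
      VFill 10 0; VOp OpPow 9 9 10; VSum 16 9;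
      SOp OpDiv 17 9 0; SOp OpPow 16 16 17;
      (* lambda = mu^s r^(s-p); the test lambda <= lambar covers lambda = 0 *)
      SOp OpSub 17 1 0; SOp OpPow 16 16 17; SOp OpPow 17 3 1;
      SOp OpMul 16 17 16; SOp OpDiv 17 12 16; SSel 18 16 12 9 17].

Definition prog_average : program :=
  [:: SOp OpMul 16 18 14; SOp OpAdd 16 6 16;
      SOp OpMul 17 14 18; VFill 7 17; VOp OpMul 7 7 6; VOp OpAdd 3 3 7;
      SOp OpSub 17 9 18; SOp OpMul 17 17 6; SOp OpMul 19 18 15;
      SOp OpDiv 20 9 16;
      VFill 7 17; VOp OpMul 7 7 1; VFill 8 19; VOp OpMul 8 8 5;
      VOp OpAdd 7 7 8; VFill 8 20; VOp OpMul 1 8 7].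

Definition prog_prox : program :=
  [:: SOp OpSub 17 0 9; SOp OpDiv 17 9 17;
      VFill 7 0; VOp OpDiv 7 3 7; VFill 8 8; VOp OpSub 9 8 7;
      VSel 9 8 7 7 9; VFill 10 17; VOp OpPow 9 9 10; VOp OpSub 10 8 9;
      VSel 9 8 7 9 10; VOp OpSub 2 0 9].

Definition prog_advance : program :=
  [:: SSel 7 5 8 16 11; SOp OpAdd 6 16 8; SOp OpAdd 5 5 9].

Definition gppa_program : program :=
  prog_lambar ++ prog_stepsize ++ prog_oracle ++ prog_beta ++ prog_average
    ++ prog_prox ++ prog_advance.

Lemma gppa_program_cost (d tau : nat) : (0 < d)%N ->
  (program_cost d tau gppa_program <= size gppa_program * d + tau)%N.
Proof.
move=> d0; rewrite /program_cost /gppa_program /=.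
rewrite !big_cons big_nil /=; lia.
Qed.

Section Exec.
Variables (R : realType) (d : nat) (f : 'rV[R]_d -> R).
Variable O : 'rV[R]_d -> 'rV[R]_d.
Implicit Types (m : memory R d).

Lemma exec_cat P Q m : exec f O (P ++ Q) m = exec f O Q (exec f O P m).
Proof. by rewrite /exec foldl_cat. Qed.

(* The comparison of register numbers is replaced by a function that computes,
   so that a read is resolved before its value is substituted elsewhere. *)
Ltac run_program m :=
  clear -m; case: m => [sr vr];
  unfold exec, exec_instr, update;
  change (@eq_op Datatypes_nat__canonical__eqtype_Equality) with eqn;
  cbv beta iota zeta delta [prog_lambar prog_stepsize prog_oracle prog_beta
    prog_average prog_prox prog_advance sreg vreg foldl eqn binop_eval].

Tactic Notation "registers_kept" integer(n) ident(m) :=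
  let k := fresh in
  intro k; do n (destruct k as [|k]; [intros _; run_program m; reflexivity|]);
  by [].

Lemma exec_lambar m (s : nat) (m' := exec f O prog_lambar m)
    (Aref := if 2 * sreg m 7 <= sreg m 6 then sreg m 6 else sreg m 7) :
  sreg m 1 = s%:R ->
  [/\ forall k, (k < 8)%N -> sreg m' k = sreg m k,
    forall k, (k < 4)%N -> vreg m' k = vreg m k,
    sreg m' 8 = 0 /\ sreg m' 9 = 1,
    sreg m' 11 = Aref
    & sreg m' 12 = if sreg m 5 <= 0 then 1 else
        lambar_rule (sreg m 0) s (sreg m 3) (sreg m 4) Aref].
Proof.
move=> s1; rewrite {}/m' {}/Aref.
split; [registers_kept 8 m|registers_kept 4 m|by run_program m|by run_program m|].
by move: s1; run_program m => s1; rewrite s1 /lambar_rule sub0r expr2.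
Qed.

Lemma exec_stepsize m (m' := exec f O prog_stepsize m) : sreg m 9 = 1 ->
  [/\ forall k, (k < 13)%N -> sreg m' k = sreg m k,
    forall k, (k < 4)%N -> vreg m' k = vreg m k,
    sreg m' 14 = step_root (sreg m 0) (step_coef (sreg m 2)) (sreg m 12) (sreg m 6)
    & sreg m' 15 = sreg m 6 + sreg m' 14].
Proof.
move=> s9; rewrite {}/m'.
split; [registers_kept 13 m|registers_kept 4 m| |by run_program m].
by move: s9; run_program m => s9; rewrite s9.
Qed.

Lemma exec_oracle m (m' := exec f O prog_oracle m) :
  [/\ forall k, (k < 16)%N -> sreg m' k = sreg m k,
    forall k, (k < 4)%N -> vreg m' k = vreg m k,
    vreg m' 4 = (sreg m 6 / sreg m 15) *: vreg m 1
              + (sreg m 14 / sreg m 15) *: vreg m 2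
    & vreg m' 5 = O (vreg m' 4) /\ vreg m' 6 = grad f (vreg m' 5)].
Proof.
rewrite {}/m'; split; [registers_kept 16 m|registers_kept 4 m| |by run_program m].
by run_program m; apply/rowP => i; rewrite !mxE.
Qed.

Lemma exec_beta m (s : nat) (m' := exec f O prog_beta m)
    (l := sreg m 3 ^+ s * lpnorm (sreg m 0) (vreg m 5 - vreg m 4)
            `^ (s%:R - sreg m 0)) :
  sreg m 1 = s%:R -> sreg m 8 = 0 -> sreg m 9 = 1 -> 0 <= sreg m 3 ->
  [/\ forall k, (k < 16)%N -> sreg m' k = sreg m k,
    forall k, (k < 7)%N -> vreg m' k = vreg m k
    & sreg m' 18 = if l <= sreg m 12 then 1 else sreg m 12 / l].
Proof.
move=> s1 s8 s9 s3; rewrite {}/l {}/m'.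
split; [registers_kept 16 m|registers_kept 7 m|].
rewrite -powR_mulrn // /lpnorm; move: s1 s8 s9 {s3}.
run_program m => s1 s8 s9; rewrite s8 s9 div1r.
rewrite (_ : (\sum_l _) = \sum_(l < d) `|(vr 5 - vr 4) 0 l| `^ sr 0); first by rewrite s1.
apply: eq_bigr => i _; rewrite !mxE sub0r; case: leP => h.
  by rewrite ger0_norm.
by rewrite ltr0_norm.
Qed.

Lemma exec_average m (m' := exec f O prog_average m) : sreg m 9 = 1 ->
  [/\ forall k, (k < 16)%N -> sreg m' k = sreg m k,
    [/\ vreg m' 0 = vreg m 0, vreg m' 2 = vreg m 2
      & vreg m' 3 = vreg m 3 + (sreg m 14 * sreg m 18) *: vreg m 6],
    sreg m' 16 = sreg m 6 + sreg m 18 * sreg m 14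
    & vreg m' 1 = (sreg m 6 + sreg m 18 * sreg m 14)^-1 *:
        (((1 - sreg m 18) * sreg m 6) *: vreg m 1
         + (sreg m 18 * sreg m 15) *: vreg m 5)].
Proof.
move=> s9; rewrite {}/m'.
split; [registers_kept 16 m| |by run_program m|].
  split; [by run_program m|by run_program m|].
  by run_program m; apply/rowP => i; rewrite !mxE.
move: s9; run_program m => s9; apply/rowP => i; rewrite !mxE s9 div1r.
by [].
Qed.

Lemma exec_prox m (m' := exec f O prog_prox m) :
  1 < sreg m 0 -> sreg m 8 = 0 -> sreg m 9 = 1 ->
  [/\ forall k, (k < 17)%N -> sreg m' k = sreg m k,
    [/\ vreg m' 0 = vreg m 0, vreg m' 1 = vreg m 1 & vreg m' 3 = vreg m 3]
    & vreg m' 2 = prox_center (sreg m 0) (vreg m 0) (vreg m 3)].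
Proof.
move=> s0 s8 s9; rewrite {}/m'; split; [registers_kept 17 m|split; by run_program m|].
move: s0 s8 s9; run_program m => s0 s8 s9.
apply/rowP => i; rewrite !mxE s8 s9 div1r !sub0r.
congr (_ - _); move: (_ / _) => x; rewrite /spow.
case: (ltgtP 0 x) => h /=.
- by rewrite gtr0_sg // mul1r gtr0_norm.
- by rewrite ltr0_sg // mulN1r ltr0_norm.
- by rewrite -h sgr0 mul0r powR0 // invr_eq0 gt_eqF // subr_gt0.
Qed.

Lemma exec_advance m (m' := exec f O prog_advance m) :
  sreg m 8 = 0 -> sreg m 9 = 1 ->
  [/\ forall k, (k < 5)%N -> sreg m' k = sreg m k,
    forall k, (k < 4)%N -> vreg m' k = vreg m k,
    sreg m' 5 = sreg m 5 + 1, sreg m' 6 = sreg m 16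
    & sreg m' 7 = if sreg m 5 <= 0 then sreg m 16 else sreg m 11].
Proof.
move=> s8 s9; rewrite {}/m'.
split; [registers_kept 5 m|registers_kept 4 m| | |]; move: s8 s9;
  run_program m => s8 s9; first by rewrite s9.
- by rewrite s8 addr0.
- by rewrite s8.
Qed.

End Exec.

(** * Correctness of the program *)

(** Registers are tracked through the consecutive parts of the program.  The
root computed by the program is the step size of the run by [step_rootE], and
its prox center is the next [z] by [run_iterz]. *)
Lemma gppa_program_correct (R : realType) (d : nat) (p : R) (s : nat)
    (sigma mu Rad : R) (f : 'rV[R]_d -> R) (step : 'rV[R]_d -> 'rV[R]_d)
    (x0 : 'rV[R]_d) (T : nat) (tr : trace R d) (m : memory R d)
    (O := fun y => (step y, mu ^+ s * pnorm p (step y - y) `^ (s%:R - p))) :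
  2 <= p -> 0 <= sigma < 1 -> 0 <= mu -> gms_oracle p sigma f O ->
  gppa_run p s sigma mu Rad f O x0 T.+1 tr ->
  holds_state p s sigma mu Rad f x0 tr T m ->
  holds_state p s sigma mu Rad f x0 tr T.+1 (exec f step gppa_program m).
Proof.
move=> p2 sg mu0 gms hrun [[s0 s1 s2 s3 s4] [s5 s6 s7] [v0 v1 v2 v3]].
have p1 : 1 < p by lra.
have TT : (T < T.+1)%N by [].
have [_ _ _ tref0 /(_ T TT) it] := hrun.
rewrite /gppa_program !exec_cat.
have := exec_lambar f step s1; cbv zeta.
move: (exec f step prog_lambar m) => m1 [a1 a2 [a8 a9] a11 a12].
have := exec_stepsize f step a9; cbv zeta.
move: (exec f step prog_stepsize m1) => m2 [b1 b2 b14 b15].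
have := exec_oracle f step m2; cbv zeta.
move: (exec f step prog_oracle m2) => m3 [c1 c2 c4 [c5 c6]].
have m3s k : (k < 8)%N -> sreg m3 k = sreg m k.
  by move=> k8; rewrite c1 ?b1 ?a1 //; apply: (leq_trans k8).
have m3_1 : sreg m3 1 = s%:R by rewrite m3s.
have m3_8 : sreg m3 8 = 0 by rewrite c1 // b1.
have m3_9 : sreg m3 9 = 1 by rewrite c1 // b1.
have m3_3 : 0 <= sreg m3 3 by rewrite m3s // s3.
have := exec_beta f step m3_1 m3_8 m3_9 m3_3; cbv zeta.
move: (exec f step prog_beta m3) => m4 [d1 d2 d18].
have m4_9 : sreg m4 9 = 1 by rewrite d1.
have := exec_average f step m4_9; cbv zeta.
move: (exec f step prog_average m4) => m5 [e1 [e0 e2 e3] e16 ev1].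
have m5s k : (k < 8)%N -> sreg m5 k = sreg m k.
  by move=> k8; rewrite e1 ?d1 ?m3s //; apply: (leq_trans k8).
have m5_0 : 1 < sreg m5 0 by rewrite m5s // s0.
have m5_8 : sreg m5 8 = 0 by rewrite e1 // d1.
have m5_9 : sreg m5 9 = 1 by rewrite e1 // d1.
have := exec_prox f step m5_0 m5_8 m5_9; cbv zeta.
move: (exec f step prog_prox m5) => m6 [g1 [g0 gv1 g3] g2].
have m6_8 : sreg m6 8 = 0 by rewrite g1.
have m6_9 : sreg m6 9 = 1 by rewrite g1.
have := exec_advance f step m6_8 m6_9; cbv zeta.
move: (exec f step prog_advance m6) => m7 [h1 h2 h5 h6 h7].
have T0 : (T%:R <= 0 :> R) = (T == 0%N) by rewrite lern0.
have Aref : (0 < T)%N -> sreg m1 11 = sumA tr (tref tr T.+1).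
  move=> T0'; rewrite a11 s6 s7 // (gppa_tref it) T0' /=.
  by case: ifP.
have lb : sreg m1 12 = lambar tr T.+1.
  rewrite a12 s5 T0 (gppa_lambar it) s0 s3 s4 -a11.
  by case: (posnP T) => [_|T0'] //; rewrite Aref.
have c0 := step_coef_gt0 sg.
have A0 := run_sumA_ge0 gms hrun (ltnW TT).
have a14 : sreg m2 14 = stepa tr T.+1.
  rewrite b14 lb !a1 // s0 s2 s6.
  exact: (step_rootE p1 c0 A0 (gppa_stepa_gt0 it) (gppa_stepa it)).
have A'E : sreg m2 15 = sumA tr T + stepa tr T.+1 by rewrite b15 a14 a1 // s6.
have yE : vreg m3 4 = itery tr T.
  by rewrite c4 A'E a14 !b2 // !a2 // b1 // a1 // s6 v1 v2 (gppa_y it).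
have [xE lE] : iterx' tr T.+1 = step (itery tr T)
   /\ lam tr T.+1 = mu ^+ s * pnorm p (iterx' tr T.+1 - itery tr T) `^ (s%:R - p).
  by have := gppa_oracle it; rewrite /O => -[-> ->].
have x'E : vreg m3 5 = iterx' tr T.+1 by rewrite c5 yE xE.
have bE : sreg m4 18 = beta tr T.+1.
  have l3 : sreg m3 3 ^+ s * lpnorm (sreg m3 0) (vreg m3 5 - vreg m3 4)
      `^ (s%:R - sreg m3 0) = lam tr T.+1.
    by rewrite lE x'E yE (m3s 3%N) // (m3s 0%N) // s3 s0 pnormE.
  have lb3 : sreg m3 12 = lambar tr T.+1 by rewrite c1 // b1.
  rewrite d18 l3 lb3 (gppa_beta it).
  have [l0 _ _] := run_gms gms hrun TT.
  have lb0 := run_lambar_ge0 hrun TT.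
  have [->|ln0] := eqVneq (lam tr T.+1) 0; first by rewrite lb0.
  have {}l0 : 0 < lam tr T.+1 by rewrite lt_neqAle eq_sym ln0.
  by rewrite minEle ler_pdivlMr // mul1r.
have m4_14 : sreg m4 14 = stepa tr T.+1 by rewrite d1 // c1.
have m4_6 : sreg m4 6 = sumA tr T by rewrite d1 // m3s.
have m4_15 : sreg m4 15 = sumA tr T + stepa tr T.+1 by rewrite d1 // c1.
have AE : sreg m5 16 = sumA tr T.+1 by rewrite e16 m4_14 m4_6 bE (gppa_A it).
have gE : vreg m5 3 = grad_sum f tr T.+1.
  rewrite e3 m4_14 bE !d2 // c2 // b2 // a2 // v3 c6 x'E.
  by rewrite /grad_sum (big_nat_recr T.+1).
have nx : vreg m5 1 = iterx tr T.+1.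
  by rewrite ev1 m4_14 m4_6 m4_15 bE !d2 // c2 // b2 // a2 // v1 x'E (gppa_x it).
split; split.
- by rewrite h1 // g1 // m5s.
- by rewrite h1 // g1 // m5s.
- by rewrite h1 // g1 // m5s.
- by rewrite h1 // g1 // m5s.
- by rewrite h1 // g1 // m5s.
- by rewrite h5 g1 // m5s // s5 natr1.
- by rewrite h6 g1.
- move=> _; rewrite h7 g1 // m5s // s5 T0 !g1 // AE.
  have t1 : T = 0%N -> tref tr T.+1 = 1%N by move=> e; rewrite (gppa_tref it) e.
  case: (posnP T) => [e|T0']; first by rewrite t1 // e.
  by rewrite e1 // d1 // c1 // b1 // Aref.
- by rewrite h2 // g0 e0 d2 // c2 // b2 // a2.
- by rewrite h2 // gv1.
- rewrite h2 // g2 gE m5s // s0 e0 d2 // c2 // b2 // a2 // v0.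
  by rewrite (run_iterz p2 hrun).
- by rewrite h2 // g3.
Qed.

(** * The theorem *)

Theorem theorem1p9 (R : realType) :
  exists sigma : R, 0 <= sigma < 1 /\
  (* one fixed program performs an iteration, at cost O(d) + one oracle call *)
  exists (P : program) (K : nat),
  (forall d tau : nat, (0 < d)%N -> (program_cost d tau P <= K * d + tau)%N) /\
  forall (p : R) (s : nat), 2 <= p -> p < s%:R ->
  (* kappa is the constant hidden in R = O(||x0 - xstar||_p) *)
  forall kappa : R, 1 <= kappa ->
  exists C : R, 0 < C /\
  forall L : R, 0 < L ->
  exists mu : R, 0 < mu /\
  forall D : R,
  exists eps0 : R, 0 < eps0 /\
  forall d : nat, (0 < d)%N ->
  exists gamma : 'rV[R]_d -> 'rV[R]_d -> R,
  forall (f : 'rV[R]_d -> R) (xstar x0 : 'rV[R]_d)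
         (taylor_step : 'rV[R]_d -> 'rV[R]_d) (Rad : R),
    convex_function [set: 'rV[R]_d] f ->
    smooth p s.-1 L f ->
    (forall x, f xstar <= f x) ->
    taylor_oracle p s L f taylor_step ->
    lpnorm p (x0 - xstar) = D ->
    D <= Rad <= kappa * D ->
  let O := fun y => (taylor_step y, gamma y (taylor_step y)) in
  let run := gppa_run p s sigma mu Rad f O x0 in
  [/\ gms_oracle p sigma f O,
      movement_bound p s mu O,
      x0 != xstar -> exists tr : trace R d, forall T, run T tr,
      (forall eps : R, 0 < eps ->
         eps <= eps0 \/ 1 <= L * D `^ (s%:R - p) ->
       forall (T : nat) (tr : trace R d), run T tr ->
         (0 < T)%N -> C * iteration_bound p s D L eps <= T%:R ->
         f (iterx tr T) - f xstar <= eps)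
    & forall (T : nat) (tr : trace R d) (m : memory R d), run T.+1 tr ->
        holds_state p s sigma mu Rad f x0 tr T m ->
        holds_state p s sigma mu Rad f x0 tr T.+1 (exec f taylor_step P m)].
Proof.
have sg : 0 <= (2^-1 : R) < 1 by apply/andP; split; lra.
exists 2^-1; split => //; exists gppa_program, (size gppa_program).
split; first exact: gppa_program_cost.
move=> p s p2 ps kappa k1; have p0 : 0 < p by lra.
exists (rate_constant p s 2^-1 kappa).
split; first exact: rate_constant_gt0.
move=> L L0; have F0 := smoothness_factor_gt0 p2 ps.
have s0 : 0 < s%:R :> R by lra.
have M0 : 0 < s%:R * L / (s.-1)`!%:R.
  by rewrite mulrAC mulr_gt0.
pose mu := (s%:R * L / (s.-1)`!%:R) `^ s%:R^-1.
have mu0 : 0 < mu by exact: powR_gt0.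
have muE : mu ^+ s = s%:R * L / (s.-1)`!%:R.
  by rewrite -powR_mulrn ?(ltW mu0) // -powRrM mulVf ?gt_eqF // powRr1 // ltW.
exists mu; split => // D.
exists (small_accuracy p s 2^-1 kappa L mu D).
split; first exact: small_accuracy_gt0.
move=> d d0; exists (fun y x => mu ^+ s * pnorm p (x - y) `^ (s%:R - p)).
move=> f xstar x0 step Rad cf sm xmin orc; rewrite pnormE => hD hR O run.
have sp0 : 0 < s%:R - p by rewrite subr_gt0.
have ss : (2 < s)%N by rewrite -(ltr_nat R); lra.
have q1 : (1 <= s.-1)%N by clear -ss; case: s ss => [|[|]].
have ssig : s%:R^-1 <= 2^-1 :> R by rewrite lef_pV2 ?posrE //; lra.
have gms : gms_oracle p 2^-1 f O.
  move=> y; rewrite /O muE /= !pnormE.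
  exact: (taylor_step_gms p2 ps ssig (ltW L0) sm (orc y)).
have mvb : movement_bound p s mu O.
  move=> y; rewrite /O /= pnormE mulrAC divff ?mul1r ?gt_eqF ?exprn_gt0 //.
  by rewrite -powRrM mulfV ?gt_eqF // powRr1 // pnorm_ge0.
have df x : differentiable f x.
  case: sm => tdf _; have : times_differentiable 1 f.
    exact: times_differentiable_le q1 tdf.
  by case.
have hD' : pnorm p (xstar - x0) = D by rewrite -hD -pnormN // opprB.
split; [exact: gms|exact: mvb| | |].
- move=> xn; exists (gppa_trace p s 2^-1 mu Rad f O x0) => T.
  apply: gppa_trace_run => //; have /andP[DR _] := hR.
  apply: lt_le_trans DR; rewrite lt_neqAle -{2}hD pnorm_ge0 andbT.
  apply/eqP => D0; move: xn; rewrite -subr_eq0 => /eqP; apply.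
  by apply: (pnorm_eq0 p0); rewrite hD.
- move=> eps e0 hreg T tr hrun T0 hT.
  exact: (gppa_rate p2 ps sg k1 L0 mu0 muE cf df xmin gms mvb hD' hR e0 hreg
    hrun T0 hT).
move=> T tr m hrun; exact: (gppa_program_correct p2 sg (ltW mu0) gms hrun).
Qed.
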